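(* Consider the impulse control model, the associated MDP, problem (P), the set $V$ and the linear programs (LP1) and (LP2) described in the context, and suppose Conditions (I) and (II) of the context are satisfied. Let $f^\ast:\mathbf X_\Delta\to\mathbf B$ be a measurable mapping with properties (i) and (ii) of the context. Then the following assertions hold. (a) The optimal values of the linear programs (LP1) and (LP2) and of the impulse control problem (P) are all the same. (b) Suppose the measure $\mu_\ast$ is optimal in the linear program (LP2). Let $\varphi_{\mu_\ast}$ be a stochastic kernel on $\mathbf B$ given $V$ satisfying $\varphi_{\mu_\ast}(db|x)\,\mu_\ast(dx\times\mathbf B)=\mu_\ast(dx\times db)$ on $\mathcal B(V\times\mathbf B)$, and let $\widetilde{\pi_{\mu_\ast}}$ be the stationary strategy $$\widetilde{\pi_{\mu_\ast}}(db|x):=\mathbb I\{x\in V\}\varphi_{\mu_\ast}(db|x)+\mathbb I\{x\in V^c\}\delta_{f^\ast(x)}(db).$$ Then the occupation measure $\mu^{\widetilde{\pi_{\mu_\ast}}}$ is an optimal solution to the linear program (LP1), and it is feasible with a finite value. In particular, the stationary strategy $\widetilde{\pi_{\mu_\ast}}$ is optimal for the impulse control problem (P). (c) If $\mu'$ is an optimal solution to the linear program (LP1), then there is an optimal solution to the linear program (LP2).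
   Context: **Impulse control model.** A Borel space is a topological space homeomorphic to a Borel subset of a Polish space. $\mathbf X$ (states) and $\mathbf A$ (impulses) are Borel spaces with their Borel $\sigma$-algebras; $J$ is a fixed natural number. $\phi:\mathbf X\times[0,\infty)\to\mathbf X$ is a measurable flow: $\phi(x,0)=x$ and $\phi(x,t+s)=\phi(\phi(x,s),t)$ for all $x\in\mathbf X$, $s,t\ge0$. $l:\mathbf X\times\mathbf A\to\mathbf X$ is measurable (the state after an impulse). For $j=0,\dots,J$, $C_j^g:\mathbf X\to[0,\infty)$ and $C_j^I:\mathbf X\times\mathbf A\to[0,\infty)$ are measurable. Fixed: an initial state $x_0\in\mathbf X$ and constants $d_1,\dots,d_J\in[0,\infty)$. **Associated MDP.** $\mathbf X_\Delta:=\mathbf X\cup\{\Delta\}$ with $\Delta\notin\mathbf X$ an isolated point; $\mathbf B:=[0,\infty]\times\mathbf A$ with the product topology. The transition kernel is $Q(dy|x,(\theta,a)):=\delta_{l(\phi(x,\theta),a)}(dy)$ if $x\ne\Delta$ and $\theta\neq\infty$, and $:=\delta_\Delta(dy)$ otherwise. The costs are $$\bar C_j(x,(\theta,a)):=\mathbb I\{x\neq\Delta\}\Big\{\int_{[0,\theta]}C_j^g(\phi(x,u))\,du+\mathbb I\{\theta<\infty\}C_j^I(\phi(x,\theta),a)\Big\},\quad j=0,\dots,J,$$ where for $\theta=\infty$ the integral is over $[0,\infty)$. **Strategies.** Histories are $h_i=(x_0,b_1,x_1,\dots,b_i,x_i)$ with $x_k\in\mathbf X_\Delta$, $b_k=(\theta_k,a_k)\in\mathbf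 B$. A strategy $\pi=\{\pi_i\}_{i=1}^\infty$ is a sequence of stochastic kernels $\pi_i(db|h_{i-1})$ on $\mathbf B$. It is stationary, denoted $\widetilde\pi$, if $\pi_i(db|h_{i-1})=\widetilde\pi(db|x_{i-1})$ for all $i$, for one stochastic kernel $\widetilde\pi$ on $\mathbf B$ given $\mathbf X_\Delta$; it is deterministic stationary, denoted $f$, if $\pi_i(db|h_{i-1})=\delta_{f(x_{i-1})}(db)$ for a measurable $f:\mathbf X_\Delta\to\mathbf B$. For an initial state $x$ and strategy $\pi$, $P^\pi_x$ (expectation $E^\pi_x$) is the Ionescu-Tulcea law of the process $X_0,B_1,X_1,B_2,\dots$ (with $B_n=(\Theta_n,A_n)$) for which $X_0=x$, $B_i$ has conditional law $\pi_i(\cdot|H_{i-1})$ given $H_{i-1}$, and $X_i$ has conditional law $Q(\cdot|X_{i-1},B_i)$ given $(H_{i-1},B_i)$. **Problem (P).** Let $\mathcal V_j(x_0,\pi):=E^\pi_{x_0}\big[\sum_{n=0}^\infty\bar C_j(X_n,B_{n+1})\big]$. Problem (P): minimize $\mathcal V_0(x_0,\pi)$ over strategies $\pi$ subject to $\mathcal V_j(x_0,\pi)\le d_j$, $j=1,\dots,J$. A strategy is feasible if it satisfies these constraints; it is optimal if it is feasible and its $\mathcal V_0(x_0,\cdot)$ is minimal among feasible strategies. **Occupation measure.** $\mu^\pi(\Gamma_1\times\Gamma_2):=E^\pi_{x_0}\big[\sum_{n=0}^\infty\mathbb I\{(X_n,B_{n+1})\in\Gamma_1\times\Gamma_2\}\big]$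 for $\Gamma_1\in\mathcal B(\mathbf X_\Delta)$, $\Gamma_2\in\mathcal B(\mathbf B)$; it is a $[0,\infty]$-valued measure on $\mathbf X_\Delta\times\mathbf B$. **Condition (I).** There is a feasible strategy $\pi$ with $\mathcal V_0(x_0,\pi)<\infty$. **Condition (II).** (a) $\mathbf A$ is compact, and $[0,\infty]$ is the one-point compactification of $[0,\infty)$; (b) $l$ is continuous on $\mathbf X\times\mathbf A$; (c) $\phi$ is continuous on $\mathbf X\times[0,\infty)$; (d) each $C_j^I$ is lower semicontinuous on $\mathbf X\times\mathbf A$; (e) each $C_j^g$ is lower semicontinuous on $\mathbf X$. **The set $V$ and the strategy $f^\ast$.** $V:=\{x\in\mathbf X_\Delta:\inf_\pi E^\pi_x[\sum_{n=0}^\infty\sum_{j=0}^J\bar C_j(X_n,B_{n+1})]>0\}$ and $V^c:=\mathbf X_\Delta\setminus V$. Under Condition (II), $V^c$ is closed in $\mathbf X_\Delta$ and there exists a measurable $f^\ast:\mathbf X_\Delta\to\mathbf B$ such that (i) $E^{f^\ast}_x[\sum_{n=0}^\infty\sum_{j=0}^J\bar C_j(X_n,B_{n+1})]=\inf_\pi E^\pi_x[\sum_{n=0}^\infty\sum_{j=0}^J\bar C_j(X_n,B_{n+1})]$ for all $x\in\mathbf X_\Delta$, and (ii) $Q(V|x,f^\ast(x))=0$ for all $x\in V^c$. **Linear program (LP1).** Minimize $\int_{\mathbf X_\Delta\times\mathbf B}\bar C_0(x,b)\,\mu(dx\times db)$ over all ($[0,\infty]$-valued) measures $\mu$ on $\mathbf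 X_\Delta\times\mathbf B$ subject to $\mu(dx\times\mathbf B)=\delta_{x_0}(dx)+\int_{\mathbf X_\Delta\times\mathbf B}Q(dx|y,b)\,\mu(dy\times db)$ and $\int_{\mathbf X_\Delta\times\mathbf B}\bar C_j(x,b)\,\mu(dx\times db)\le d_j$, $j=1,\dots,J$. **Linear program (LP2).** Minimize $\int_{V\times\mathbf B}\bar C_0(x,b)\,\mu(dx\times db)$ over $\sigma$-finite measures $\mu$ on $V\times\mathbf B$ subject to $\mu(dx\times\mathbf B)=\delta_{x_0}(dx)+\int_{V\times\mathbf B}Q(dx|y,b)\,\mu(dy\times db)$ on $\mathcal B(V)$ and $\int_{V\times\mathbf B}\bar C_j(x,b)\,\mu(dx\times db)\le d_j$, $j=1,\dots,J$. In either program, a feasible measure has a finite value if its objective ($j=0$) integral is finite, and an optimal solution is a feasible measure attaining the minimum. Under Conditions (I) and (II), a kernel $\varphi_\mu$ as in part (b) exists for each feasible measure $\mu$ with a finite value. *)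

(* Defs.v *)
From HB Require Import structures.
From mathcomp Require Import all_boot all_order all_algebra.
From mathcomp Require Import all_classical all_reals all_analysis.
From mathcomp Require Import measurable_realfun.

Set Implicit Arguments.
Unset Strict Implicit.
Unset Printing Implicit Defensive.
Import Order.TTheory GRing.Theory Num.Theory.
Import numFieldNormedType.Exports.

Local Open Scope classical_set_scope.
Local Open Scope ring_scope.

Definition borel (T : ptopologicalType) := g_sigma_algebraType (@open T).
HB.instance Definition _ (T : ptopologicalType) :=
  Measurable.on (borel T).

Definition homeomorphic (S T : topologicalType) : Prop :=
  exists (f : S -> T) (g : T -> S),
    [/\ continuous f, continuous g, cancel f g & cancel g f].

Definition polish_space (R : realType) (T : topologicalType) : Prop :=
  (exists2 D : set T, countable D & dense D) /\
  exists M : metricType R, homeomorphic T M /\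
    forall F : set_system M, ProperFilter F -> cauchy F ->
      exists x : M, F --> x.

Definition borel_space (R : realType) (T : topologicalType) : Prop :=
  exists (P : ptopologicalType) (S : set P),
    [/\ polish_space R P, <<s @open P >> S & homeomorphic T S].

(* T together with the additional point None, which is isolated. *)
Definition add_isolated (T : Type) : Type := option T.

Section add_isolated_topology.
Variable T : topologicalType.

HB.instance Definition _ := Choice.on (add_isolated T).
HB.instance Definition _ := Pointed.on (add_isolated T).

Let op (U : set (add_isolated T)) := open (Some @^-1` U).

Let opT : op setT.
Proof. exact: openT. Qed.

Let opI : setI_closed op.
Proof. by move=> A B oA oB; exact: openI. Qed.

Let op_bigU (I : Type) (f : I -> set (add_isolated T)) :
  (forall i, op (f i)) -> op (\bigcup_i f i).
Proof. by move=> of_; rewrite /op preimage_bigcup; apply: bigcup_open => i _; exact: of_. Qed.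

HB.instance Definition _ :=
  isOpenTopological.Build (add_isolated T) opT opI op_bigU.

End add_isolated_topology.

(* [0, +oo] as the one-point compactification of [0, +oo[: None is +oo. *)
Definition extended_time (R : realType) : ptopologicalType :=
  one_point_compactification (set_type [set t : R | 0 <= t]).

(* Times are reals; flow is only constrained (and only used) at times t >= 0.
   Costs are indexed by j = 0, ..., J. *)
Record impulse_model (R : realType) (X A : ptopologicalType) (J : nat) := {
  flow : X -> R -> X ;
  jump : X -> A -> X ;
  gcost : 'I_J.+1 -> X -> R ;
  icost : 'I_J.+1 -> X -> A -> R ;
  flow0 : forall x, flow x 0 = x ;
  flowD : forall x s t, 0 <= s -> 0 <= t ->
    flow x (t + s) = flow (flow x s) t ;
  measurable_flow : measurable_fun [set p : borel X * R | 0 <= p.2]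
    ((fun p => flow p.1 p.2) : borel X * R -> borel X) ;
  measurable_jump : measurable_fun setT
    ((fun p => jump p.1 p.2) : borel X * borel A -> borel X) ;
  gcost_ge0 : forall j x, 0 <= gcost j x ;
  icost_ge0 : forall j x a, 0 <= icost j x a ;
  measurable_gcost : forall j, measurable_fun setT (gcost j : borel X -> R) ;
  measurable_icost : forall j, measurable_fun setT
    ((fun p => icost j p.1 p.2) : borel X * borel A -> R) }.

Section mdp.
Context {R : realType} {X A : ptopologicalType} {J : nat}.
Variable M : impulse_model R X A J.
Local Open Scope ereal_scope.

Definition state := borel (add_isolated X).
(* X and A being second countable, the product sigma-algebras used here and
   below are the Borel sigma-algebras of the product topologies. *)
Definition action := (borel (extended_time R) * borel A)%type.
HB.instance Definition _ := Measurable.on state.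
HB.instance Definition _ := Measurable.on action.

Definition next_state (x : state) (b : action) : state :=
  match x, b.1 with
  | Some y, Some t => Some (jump M (flow M y (\val t)) b.2)
  | _, _ => None
  end.

Definition transition (x : state) (b : action) : probability state R :=
  \d_(next_state x b).

Definition stage_cost (j : 'I_J.+1) (x : state) (b : action) : \bar R :=
  match x, b.1 with
  | None, _ => 0
  | Some y, Some t =>
      \int[lebesgue_measure]_(u in `[0%R, \val t]) (gcost M j (flow M y u))%:E
      + (icost M j (flow M y (\val t)) b.2)%:E
  | Some y, None =>
      \int[lebesgue_measure]_(u in `[0%R, +oo[) (gcost M j (flow M y u))%:E
  end.

(* The history (x_0, b_1, x_1, ..., b_i, x_i) is encoded as
   ([(x_0, b_1); ...; (x_{i-1}, b_i)], x_i). *)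
Definition history (i : nat) := (i.-tuple (state * action) * state)%type.
HB.instance Definition _ i := Measurable.on (history i).

(* pi i is the law of the (i+1)-st action given the history up to x_i. *)
Definition strategy := forall i : nat, R.-pker (history i) ~> action.

Section stationary.
Variable k : R.-pker state ~> action.

Definition stationary_kernel (i : nat) (h : history i) :
  {measure set action -> \bar R} := k h.2.

Let measurable_stationary_kernel i U : measurable U ->
  measurable_fun setT ((@stationary_kernel i) ^~ U).
Proof.
move=> mU; apply: (measurableT_comp (measurable_kernel k U mU)).
exact: measurable_snd.
Qed.

HB.instance Definition _ i := isKernel.Build _ _ _ _ _
  (@stationary_kernel i) (@measurable_stationary_kernel i).

Let stationary_kernel_prob i h : @stationary_kernel i h setT = 1.
Proof. exact: prob_kernel. Qed.

HB.instance Definition _ i := Kernel_isProbability.Build _ _ _ _ _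
  (@stationary_kernel i) (@stationary_kernel_prob i).

Definition stationary : strategy := fun i => @stationary_kernel i.

End stationary.

Definition deterministic_stationary (f : state -> action)
  (mf : measurable_fun setT f) : strategy := stationary (kdirac mf).

(* Trajectories: w n is the pair (X_n, B_{n+1}). *)
Definition path := nat -> state * action.
HB.instance Definition _ := Pointed.on path.

Definition cylinders : set (set path) :=
  [set C | exists n (U : set (state * action)),
     measurable U /\ C = [set w | U (w n)]].

Definition path_space := g_sigma_algebraType cylinders.
HB.instance Definition _ := Measurable.on path_space.

Definition path_prefix (n : nat) (w : path_space) : n.-tuple (state * action) :=
  [tuple w k | k < n].

Definition path_history (i : nat) (w : path_space) : history i :=
  (path_prefix i w, (w i).1).

(* The prefix of length i.+1 is (X_0, B_1, ..., X_i, B_{i+1}), the conditioning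
   variable of the law of X_{i+1}. *)
Definition is_law (pi : strategy) (x : state) (P : probability path_space R) :=
  [/\ forall U : set state, measurable U ->
        P [set w | U (w 0%N).1] = \d_x U,
      forall i (G : set (history i)) (U : set action),
        measurable G -> measurable U ->
        P [set w | G (path_history i w) /\ U (w i).2] =
        \int[P]_(w in [set w | G (path_history i w)])
          pi i (path_history i w) U
    & forall i (G : set (i.+1.-tuple (state * action))) (U : set state),
        measurable G -> measurable U ->
        P [set w | G (path_prefix i.+1 w) /\ U (w i.+1).1] =
        \int[P]_(w in [set w | G (path_prefix i.+1 w)])
          transition (w i).1 (w i).2 U].

(* By the Ionescu-Tulcea theorem there is exactly one such P. *)
Definition law (pi : strategy) (x : state) : probability path_space R :=
  get (is_law pi x).

Definition expectation (pi : strategy) (x : state) (F : path_space -> \bar R) :=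
  \int[law pi x]_w F w.

Definition total_cost (pi : strategy) (x : state) (j : 'I_J.+1) : \bar R :=
  expectation pi x (fun w =>
    \sum_(0 <= n <oo) stage_cost j (w n).1 (w n).2).

Definition aggregate_cost (pi : strategy) (x : state) : \bar R :=
  expectation pi x (fun w =>
    \sum_(0 <= n <oo) \sum_(j < J.+1) stage_cost j (w n).1 (w n).2).

Definition optimal_aggregate_cost (x : state) : \bar R :=
  ereal_inf [set aggregate_cost pi x | pi in setT].

Definition Vset : set state := [set x | 0 < optimal_aggregate_cost x].

Section occupation_measure.
Variables (pi : strategy) (x : state).

Definition occupation (U : set (state * action)) : \bar R :=
  expectation pi x (fun w => \sum_(0 <= n <oo) (\1_U (w n))%:E).

Let measurable_coord n : measurable_fun setT (fun w : path_space => w n).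
Proof.
move=> _ U mU; rewrite setTI; apply: sub_sigma_algebra; exists n, U.
by split.
Qed.

Let measurable_coord_indic n (U : set (state * action)) : measurable U ->
  measurable_fun setT (fun w : path_space => (\1_U (w n))%:E : \bar R).
Proof.
move=> mU.
have h : measurable_fun [set: state * action]
    ((fun p => (\1_U p)%:E) : _ -> \bar R).
  by apply/measurable_EFinP; exact: measurable_indic.
exact: (measurableT_comp h (measurable_coord n)).
Qed.

Let occupation0 : occupation set0 = 0.
Proof.
apply: integral0_eq => w _; apply: eseries0 => n _ _.
by rewrite indic0.
Qed.

Let occupation_ge0 U : 0 <= occupation U.
Proof.
apply: integral_ge0 => w _; apply: nneseries_ge0 => n _ _.
by rewrite lee_fin.
Qed.

Let indic_ge0 (U : set (state * action)) p : 0 <= (\1_U p)%:E :> \bar R.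
Proof. by rewrite lee_fin. Qed.

Let measurable_visits (U : set (state * action)) : measurable U ->
  measurable_fun setT
    ((fun w : path_space => \sum_(0 <= n <oo) (\1_U (w n))%:E) : _ -> \bar R).
Proof.
move=> mU; apply: (@ge0_emeasurable_sum _ _ _ setT
  (fun n (w : path_space) => (\1_U (w n))%:E) predT).
  by move=> n w _ _; exact: indic_ge0.
by move=> n _; exact: measurable_coord_indic.
Qed.

Let occupation_sigma_additive : semi_sigma_additive occupation.
Proof.
move=> F mF tF mUF.
have -> : occupation (\bigcup_n F n) = \sum_(0 <= k <oo) occupation (F k).
  rewrite /occupation /expectation -integral_nneseries//.
  - apply: eq_integral => w _; rewrite nneseries_interchange//.
    by apply: eq_eseriesr => n _; exact: indic_bigcup.
  - by move=> k; exact: measurable_visits.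
  - by move=> k w _; apply: nneseries_ge0 => n _ _; exact: indic_ge0.
by apply: is_cvg_nneseries => k _ _; exact: occupation_ge0.
Qed.

HB.instance Definition _ := isMeasure.Build _ _ _ occupation
  occupation0 occupation_ge0 occupation_sigma_additive.

End occupation_measure.

(* The constraint indices 1, ..., J are the [lift ord0 j] with j : 'I_J. *)
Section problems.
Variables (x0 : X) (d : 'I_J -> R).

Let s0 : state := Some x0.

Definition feasible (pi : strategy) : Prop :=
  forall j : 'I_J, total_cost pi s0 (lift ord0 j) <= (d j)%:E.

Definition optimal (pi : strategy) : Prop :=
  feasible pi /\
  forall pi', feasible pi' -> total_cost pi s0 ord0 <= total_cost pi' s0 ord0.

Definition value : \bar R :=
  ereal_inf [set total_cost pi s0 ord0 | pi in feasible].

Implicit Types mu : {measure set (state * action) -> \bar R}.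

Definition cost_integral (D : set (state * action)) mu (j : 'I_J.+1) : \bar R :=
  \int[mu]_(p in D) stage_cost j p.1 p.2.

Definition feasible_LP1 mu : Prop :=
  (forall G : set state, measurable G ->
     mu (G `*` setT) = \d_s0 G + \int[mu]_p transition p.1 p.2 G) /\
  (forall j : 'I_J, cost_integral setT mu (lift ord0 j) <= (d j)%:E).

Definition optimal_LP1 mu : Prop :=
  feasible_LP1 mu /\
  forall mu', feasible_LP1 mu' ->
    cost_integral setT mu ord0 <= cost_integral setT mu' ord0.

Definition value_LP1 : \bar R :=
  ereal_inf [set cost_integral setT mu ord0 | mu in feasible_LP1].

(* A measure on V x B is encoded as a measure on the whole product space that
   vanishes outside V x B. *)
Definition feasible_LP2 mu : Prop :=
  let VB := Vset `*` [set: action] in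
  [/\ mu (~` VB) = 0,
      sigma_finite VB mu,
      forall G : set state, measurable G -> G `<=` Vset ->
        mu (G `*` setT) = \d_s0 G + \int[mu]_(p in VB) transition p.1 p.2 G
    & forall j : 'I_J, cost_integral VB mu (lift ord0 j) <= (d j)%:E].

Definition optimal_LP2 mu : Prop :=
  feasible_LP2 mu /\
  forall mu', feasible_LP2 mu' ->
    cost_integral (Vset `*` setT) mu ord0 <=
    cost_integral (Vset `*` setT) mu' ord0.

Definition value_LP2 : \bar R :=
  ereal_inf [set cost_integral (Vset `*` setT) mu ord0 | mu in feasible_LP2].

Definition condition_I : Prop :=
  exists2 pi, feasible pi & total_cost pi s0 ord0 < +oo.

End problems.

(* The topology of [0, +oo] is fixed by the definition of extended_time. *)
Definition condition_II : Prop :=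
  [/\ compact [set: A],
      continuous (fun p : X * A => jump M p.1 p.2),
      {within [set p : X * R | (0 <= p.2)%R],
        continuous (fun p : X * R => flow M p.1 p.2)},
      forall j, lower_semicontinuous (fun p : X * A => (icost M j p.1 p.2)%:E)
    & forall j, lower_semicontinuous (fun x : X => (gcost M j x)%:E)].

(* phi is a stochastic kernel on B given V (its values outside V are
   irrelevant) such that phi(db|x) mu(dx x B) = mu(dx x db) on V x B. *)
Definition disintegrates (mu : {measure set (state * action) -> \bar R})
    (phi : state -> probability action R) : Prop :=
  (forall U, measurable U -> measurable_fun Vset (fun x => phi x U)) /\
  (forall G : set (state * action), measurable G -> G `<=` Vset `*` setT ->
     \int[pushforward mu fst]_(x in Vset) phi x (xsection G x) = mu G).

Definition pasted (phi : state -> probability action R) (f : state -> action)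
    (x : state) : probability action R :=
  if x \in Vset then phi x else \d_(f x).

(* f attains the infimum defining Vset, and never leaves the complement of
   Vset once there. *)
Definition optimal_selector (f : state -> action)
    (mf : measurable_fun setT f) : Prop :=
  (forall x, aggregate_cost (deterministic_stationary mf) x =
     optimal_aggregate_cost x) /\
  (forall x, ~ Vset x -> transition x (f x) Vset = 0).

End mdp.

Arguments state : clear implicits.
Arguments action : clear implicits.

(* Main.v *)
From HB Require Import structures.
Require Import Defs.
From mathcomp Require Import all_boot all_order all_algebra.
From mathcomp Require Import all_classical all_reals all_analysis.
From mathcomp Require Import measurable_realfun.
From mathcomp Require Import lra.

(* For a measure mu feasible in either program with finite value, the sets
   [costly k] below exhaust V and have finite mu-marginal: from a point of
   [costly (k+1)] every action either costs more than 1/(k+1) at once or leads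
   to [costly k].  By compactness of the action space, from a point outside all
   of them one can move forever at zero cost, so V is contained in their union.
   Hence mu disintegrates over V; running the resulting kernel on V and f outside
   gives a stationary strategy whose occupation measure is minimal among the
   solutions of the balance inequality, so it is at most mu on V x B, while it
   costs nothing outside V.  So each value is at least the value of (P), and
   conversely occupation measures are feasible.

   Laws of processes and disintegrations are both obtained by simulation: the
   action space is a measurable retract of the real line, so a kernel is the
   law of a quantile function of a uniform variable, and one uniform variable
   can be split measurably into two independent ones. *)

Set Implicit Arguments.
Unset Strict Implicit.
Unset Printing Implicit Defensive.
Import Order.TTheory GRing.Theory Num.Theory.
Import numFieldNormedType.Exports.

Local Open Scope classical_set_scope.
Local Open Scope ring_scope.
Local Open Scope ereal_scope.

(** * Measurable retracts of the real line *)

(** Solutions of (LP1) need not be sigma-finite: balance can force infinite mass on absorbing states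
    such as the cemetery. On V it is the costs that limit the mass. This is why [costly] asks for a
    quantitative lower bound and not just positivity, and why its levels are open: lower
    semicontinuity and compactness then give one bound valid for all actions near a given state.
    Balance also behaves badly under restriction. A solution of (LP1), or the occupation measure of
    an arbitrary strategy, may send mass back into V from outside, so on V x B it satisfies an
    inequality only. Solutions of (LP2) are therefore taken from strategies that follow f outside V;
    these never return to V, and the inequality becomes an equality. Only actions have to be
    simulated, since the next state is a function of state and action. So only the action space must
    be a retract of the line; compactness of A serves here too, by making the set of digit sequences
    that code a point measurable. *)

Section ternary.
Context {R : realType}.

(** Base 3 with digits 0 and 2 only, as in the Cantor set: such expansions are never ambiguous, so
    the digits can be read back from the number. *)
Definition ternary_term (c : nat -> bool) (n : nat) : R :=
  ((c n)%:R * 2 * 3^-1 ^+ n.+1)%R.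

Definition ternary (c : nat -> bool) : \bar R :=
  \sum_(0 <= n <oo) (ternary_term c n)%:E.

Lemma ternary_term_ge0 c n : (0 <= ternary_term c n)%R.
Proof. by rewrite /ternary_term !mulr_ge0// exprn_ge0. Qed.

Lemma ternary_le1 c : ternary c <= 1.
Proof.
apply: lime_le; first by apply: is_cvg_nneseries => n _ _;
  rewrite lee_fin ternary_term_ge0.
apply: nearW => n; rewrite sumEFin lee_fin.
suff : (\sum_(0 <= k < n) ternary_term c k <= 1 - 3^-1 ^+ n)%R.
  by move/le_trans; apply; rewrite gerBl exprn_ge0.
elim: n => [|n ih]; first by rewrite big_nil expr0 subrr.
rewrite big_nat_recr//=; apply: (le_trans (lerD ih (lexx _))).
rewrite /ternary_term exprS.
have : (0 <= 3^-1 ^+ n :> R)%R by rewrite exprn_ge0.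
set y := (3^-1 ^+ n)%R; case: (c n) => /= y0; lra.
Qed.

Lemma ternary_ge0 c : 0 <= ternary c.
Proof. by apply: nneseries_ge0 => n _ _; rewrite lee_fin ternary_term_ge0. Qed.

Lemma ternary_fin_num c : ternary c \is a fin_num.
Proof.
by rewrite ge0_fin_numE ?ternary_ge0// (le_lt_trans (ternary_le1 c))// ltry.
Qed.

Lemma ternary_shift c :
  3%:E * ternary c = ((c 0%N)%:R * 2)%:E + ternary (fun n => c n.+1).
Proof.
rewrite /ternary nneseries_recl//; last by move=> *;
  rewrite lee_fin ternary_term_ge0.
rewrite -(nneseries_addn 1%N); last by move=> i; rewrite lee_fin ternary_term_ge0.
rewrite ge0_muleDr ?lee_fin ?ternary_term_ge0//; last first.
  by apply: nneseries_ge0 => n _ _; rewrite lee_fin ternary_term_ge0.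
congr (_ + _).
  by rewrite -EFinM; congr EFin; rewrite /ternary_term expr1; lra.
rewrite -nneseriesZl; last by move=> *; rewrite lee_fin ternary_term_ge0.
apply: eq_eseriesr => n _; rewrite -EFinM; congr EFin.
by rewrite /ternary_term addn1 (exprS _ n.+1); lra.
Qed.

(** Shift of the expansion. A number with first digit 0 is at most 1/3 and one with first digit 2 is
    at least 2/3, so the threshold 1/2 reads the digit. *)
Fixpoint residue (x : R) (n : nat) : R :=
  if n is k.+1 then (3 * residue x k - (2^-1 < residue x k)%R%:R * 2)%R else x.

Definition ternary_digit (x : R) (n : nat) : bool := (2^-1 < residue x n)%R.

Lemma fine_ternary_digit0 c : (2^-1 < fine (ternary c))%R = c 0%N.
Proof.
have := ternary_shift c; rewrite -(fineK (ternary_fin_num c)).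
rewrite -(fineK (ternary_fin_num (fun n => c n.+1))) -EFinM -EFinD => -[].
have : (0 <= fine (ternary (fun n => c n.+1)) <= 1)%R.
  by rewrite fine_ge0 ?ternary_ge0//= -lee_fin fineK ?ternary_fin_num// ternary_le1.
set y := fine _; set x := fine _.
by case: (c 0%N) => /= y01 xy; [apply/idP|apply/negbTE]; lra.
Qed.

Lemma residue_ternary c n :
  residue (fine (ternary c)) n = fine (ternary (fun k => c (n + k)%N)).
Proof.
elim: n => [|n ih] //=; rewrite ih fine_ternary_digit0.
have := ternary_shift (fun k => c (n + k)%N).
have -> : (fun k => c (n + k.+1)%N) = (fun k => c (n.+1 + k)%N).
  by apply/funext => k; rewrite addnS.
rewrite -(fineK (ternary_fin_num (fun k => c (n + k)%N))).
rewrite -(fineK (ternary_fin_num (fun k => c (n.+1 + k)%N))).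
by rewrite -EFinM -EFinD => -[->]; rewrite addrAC subrr add0r.
Qed.

Lemma ternaryK c n : ternary_digit (fine (ternary c)) n = c n.
Proof. by rewrite /ternary_digit residue_ternary fine_ternary_digit0 addn0. Qed.

Lemma measurable_residue n : measurable_fun [set: R] (residue ^~ n).
Proof.
elim: n => [|n ih] /=; first exact: measurable_id.
apply: measurable_funB; first exact: measurable_funM.
apply: measurable_funM => //.
under eq_fun do rewrite -[(_ < _)%R]/(ternary_digit _ n).
apply: (@measurableT_comp _ _ _ _ _ _ (fun b : bool => b%:R : R)) => //.
exact: measurable_fun_ltr.
Qed.

Lemma measurable_ternary_digit n :
  measurable_fun [set: R] (ternary_digit ^~ n).
Proof. by apply: measurable_fun_ltr => //; exact: measurable_residue. Qed.

Lemma measurable_ternary d (T : measurableType d) (c : T -> nat -> bool) :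
  (forall n, measurable_fun setT (c ^~ n)) ->
  measurable_fun setT (fun t => fine (ternary (c t))).
Proof.
move=> mc; apply: (measurableT_comp (fine_measurable measurableT)).
apply: ge0_emeasurable_sum => [n x _ _|n _].
  by rewrite lee_fin ternary_term_ge0.
apply/measurable_EFinP; apply: measurable_funM => //.
apply: measurable_funM => //.
exact: (@measurableT_comp _ _ _ _ _ _ (fun b : bool => b%:R : R)).
Qed.

End ternary.

Section inf_rat.
Context {R : realType}.

(** Real-valued functions are built as infima over rationals, so that their measurability reduces to
    countably many events, one for each rational. *)
Definition inf_rat (D : set rat) : \bar R := ereal_inf [set (ratr q)%:E | q in D].

Lemma inf_rat_lt D (t : R) :
  inf_rat D < t%:E <-> exists2 q, D q & (ratr q < t :> R)%R.
Proof.
split=> [/ereal_inf_lt[_ [q Dq <-]]|[q Dq qt]]; first by rewrite lte_fin; exists q.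
by apply: (@le_lt_trans _ _ (ratr q)%:E); [apply: ereal_inf_lbound; exists q|].
Qed.

Lemma measurable_inf_rat d (T : measurableType d) (D : rat -> set T) :
  (forall q, measurable (D q)) ->
  measurable_fun setT (fun t => inf_rat [set q | D q t]).
Proof.
move=> mD; apply: (measurability _ (ErealGenInftyO.measurableE R)) => //.
move=> _ [_ [t ->] <-]; rewrite setTI.
rewrite [X in measurable X](_ : _ = \bigcup_(q in [set q : rat | (ratr q < t)%R]) D q).
  rewrite bigcup_mkcond; apply: countable_bigcupT_measurable => // q.
  by case: ifPn.
apply/seteqP; split => x /=; rewrite in_itv/=.
  by move/inf_rat_lt => -[q Dq qt]; exists q.
by move=> [q qt Dq]; apply/inf_rat_lt; exists q.
Qed.

End inf_rat.

Section real_retract.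
Context {R : realType}.

(** A one-sided inverse, with no condition on the image of [s]: enough to carry laws to the line and
    back, and easily stable under products. *)
Definition real_retract d (T : measurableType d) : Prop :=
  exists (s : T -> R) (g : R -> T),
    [/\ measurable_fun setT s, measurable_fun setT g & cancel s g].

Lemma real_retract_trans d d' (T : measurableType d) (T' : measurableType d')
    (s : T -> T') (g : T' -> T) :
  measurable_fun setT s -> measurable_fun setT g -> cancel s g ->
  real_retract T' -> real_retract T.
Proof.
move=> ms mg sg [s' [g' [ms' mg' sg']]].
exists (s' \o s), (g \o g'); split; [exact: measurableT_comp..|].
by move=> t /=; rewrite sg' sg.
Qed.

Definition cut (x : R) (n : nat) : bool :=
  if @unpickle rat n is Some q then (x < ratr q)%R else false.

Definition uncut (c : nat -> bool) : R := fine (inf_rat [set q | c (pickle q)]).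

Lemma cutK : cancel cut uncut.
Proof.
move=> x; rewrite /uncut.
suff -> : inf_rat [set q : rat | cut x (pickle q)] = x%:E :> \bar R by [].
apply/eqP; rewrite eq_le; apply/andP; split; last first.
  apply: le_ereal_inf_tmp => _ [q /= + <-].
  by rewrite /cut pickleK lee_fin => /ltW.
apply/lee_addgt0Pr => e e0.
have [q /itvP xq] := @rat_in_itvoo _ x (x + e)%R (ltac:(lra)).
apply: (@le_trans _ _ (ratr q)%:E); last by rewrite -EFinD lee_fin xq.
by apply: ereal_inf_lbound; exists q => //=; rewrite /cut pickleK xq.
Qed.

Lemma measurable_cut n : measurable_fun [set: R] (cut ^~ n).
Proof.
rewrite /cut; case: unpickle => [q|]; last exact: measurable_cst.
exact: measurable_fun_ltr.
Qed.

Lemma measurable_uncut d (T : measurableType d) (c : T -> nat -> bool) :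
  (forall n, measurable_fun setT (c ^~ n)) ->
  measurable_fun setT (fun t => uncut (c t)).
Proof.
move=> mc; apply: (measurableT_comp (fine_measurable measurableT)).
apply: (@measurable_inf_rat R _ _ (fun q => [set t | c t (pickle q)])) => q.
have := mc (pickle q) measurableT [set true] (ltac:(by [])).
by rewrite setTI.
Qed.

(** Coding the cut of [s t] once more by a ternary expansion makes the retraction bounded.
    Distribution functions then vanish below 0 and equal 1 from 1 on, as [quantile_lt] requires. *)
Lemma real_retract01 d (T : measurableType d) : real_retract T ->
  exists (s : T -> R) (g : R -> T),
    [/\ measurable_fun setT s, measurable_fun setT g, cancel s g &
        forall t, (0 <= s t <= 1)%R].
Proof.
move=> [s [g [ms mg sg]]].
exists (fun t => fine (ternary (cut (s t)))), (fun x => g (uncut (ternary_digit x))).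
split.
- by apply: measurable_ternary => n; exact: (measurableT_comp (measurable_cut n) ms).
- apply: (measurableT_comp mg); apply: measurable_uncut => n.
  exact: measurable_ternary_digit.
- move=> t /=; rewrite -[RHS]sg -[in RHS](cutK (s t)); congr (g (uncut _)).
  by apply/funext => n; rewrite ternaryK.
- move=> t; rewrite fine_ge0 ?ternary_ge0//= -lee_fin fineK ?ternary_fin_num//.
  exact: ternary_le1.
Qed.

Definition interleave (c e : nat -> bool) (n : nat) :=
  if odd n then e n./2 else c n./2.

Lemma real_retract_RR : real_retract (R * R)%type.
Proof.
exists (fun p => fine (ternary (interleave (cut p.1) (cut p.2)))).
exists (fun x => (uncut (fun n => ternary_digit x n.*2),
                  uncut (fun n => ternary_digit x n.*2.+1))); split.
- apply: measurable_ternary => n; rewrite /interleave.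
  case: odd; last exact: (measurableT_comp (measurable_cut _) measurable_fst).
  exact: (measurableT_comp (measurable_cut _) measurable_snd).
- by apply: measurable_fun_pair; apply: measurable_uncut => n;
    exact: measurable_ternary_digit.
- move=> [x y] /=; congr (_, _); rewrite -[RHS]cutK; congr uncut;
    apply/funext => n; rewrite ternaryK /interleave /= odd_double ?uphalf_double ?doubleK//.
Qed.

Lemma real_retract_prod d d' (T : measurableType d) (T' : measurableType d') :
  real_retract T -> real_retract T' -> real_retract (T * T')%type.
Proof.
move=> [s [g [ms mg sg]]] [s' [g' [ms' mg' sg']]].
apply: (@real_retract_trans _ _ _ _ (fun p => (s p.1, s' p.2))
  (fun p => (g p.1, g' p.2)) _ _ _ real_retract_RR).
- apply: measurable_fun_pair; first exact: (measurableT_comp ms measurable_fst).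
  exact: (measurableT_comp ms' measurable_snd).
- apply: measurable_fun_pair; first exact: (measurableT_comp mg measurable_fst).
  exact: (measurableT_comp mg' measurable_snd).
- by move=> [x y]; rewrite /= sg sg'.
Qed.

End real_retract.

(** * Quantile functions *)

Section measure_facts.
Context {R : realType}.

Definition image_measure d1 d2 (T1 : measurableType d1) (T2 : measurableType d2)
    (mu : {measure set T1 -> \bar R}) (f : T1 -> T2)
    (mf : measurable_fun setT f) : {measure set T2 -> \bar R} :=
  measure_function_pushforward__canonical__measure_function_Measure mu mf.

Lemma image_measureE d1 d2 (T1 : measurableType d1) (T2 : measurableType d2)
    (mu : {measure set T1 -> \bar R}) (f : T1 -> T2)
    (mf : measurable_fun setT f) U : image_measure mu mf U = mu (f @^-1` U).
Proof. by []. Qed.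

Lemma ge0_integral_image_measure d1 d2 (T1 : measurableType d1)
    (T2 : measurableType d2) (mu : {measure set T1 -> \bar R}) (f : T1 -> T2)
    (mf : measurable_fun setT f) (D : set T2) (g : T2 -> \bar R) :
  measurable D -> measurable_fun setT g -> (forall y, 0 <= g y) ->
  \int[image_measure mu mf]_(y in D) g y = \int[mu]_(x in f @^-1` D) g (f x).
Proof.
by move=> mD mg g0; apply: ge0_integral_pushforward => //; exact: measurable_funTS.
Qed.

Lemma measure_unique_rectangles d1 d2 (T1 : measurableType d1)
    (T2 : measurableType d2) (m1 m2 : {measure set (T1 * T2) -> \bar R}) :
  m1 setT < +oo ->
  (forall A B, measurable A -> measurable B -> m1 (A `*` B) = m2 (A `*` B)) ->
  forall X, measurable X -> m1 X = m2 X.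
Proof.
move=> m1oo m12 X mX.
apply: (measure_unique [set A `*` B | A in measurable & B in measurable]
  (fun=> setT)) => //.
- by rewrite measurable_prod_measurableType.
- move=> _ _ [A mA [B mB <-]] [A' mA' [B' mB' <-]].
  by rewrite -setXI; exists (A `&` A'); [exact: measurableI|
    exists (B `&` B'); [exact: measurableI|]].
- by move=> _; exists setT => //; exists setT => //; rewrite setXTT.
- by rewrite bigcup_const.
- by move=> _ [A mA [B mB <-]]; exact: m12.
Qed.

Lemma real_measure_unique (m1 m2 : {measure set R -> \bar R}) :
  m1 setT < +oo ->
  (forall q : rat, m1 `]-oo, ratr q[%classic = m2 `]-oo, ratr q[%classic) ->
  forall X, measurable X -> m1 X = m2 X.
Proof.
move=> m1oo m12 X mX.
pose r (n : nat) : set R := `]-oo, (ratr (n%:R : rat) : R)[%classic.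
apply: (measure_unique [set A | exists q : rat, A = `]-oo, (ratr q : R)[%classic] r) => //.
- transitivity (@ocitv R).-sigma.-measurable => //.
  rewrite RGenInftyO.measurableE; apply/seteqP; split; last first.
    apply: smallest_sub; first exact: smallest_sigma_algebra.
    by move=> _ [q ->]; apply: sub_sigma_algebra; exists (ratr q).
  apply: smallest_sub; first exact: smallest_sigma_algebra.
  move=> _ [x ->].
  rewrite [X in _ X](_ : _ = \bigcup_(q in [set q : rat | (ratr q < x)%R])
      `]-oo, (ratr q : R)[%classic); last first.
    apply/seteqP; split => y /=; rewrite in_itv/=.
      move=> yx; have [q] := rat_in_itvoo yx; rewrite in_itv/= => /andP[yq qx].
      by exists q => //=; rewrite in_itv.
    by move=> [q /= qx]; rewrite ?in_itv/= => /lt_trans; exact.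
  rewrite bigcup_mkcond.
  apply: (@countable_bigcupT_measurable _ (g_sigma_algebraType
    [set A | exists q : rat, A = `]-oo, (ratr q : R)[%classic]) rat) => // q.
  by case: ifPn => // _; apply: sub_sigma_algebra; exists q.
- move=> _ _ [q ->] [q' ->]; exists (Order.min q q').
  apply/seteqP; split => y /=; rewrite !in_itv/=.
    by move=> [yq yq']; rewrite minEle; case: ifP.
  move=> yqq'; split; apply: (lt_le_trans yqq'); rewrite ler_rat ge_min lexx//.
  by rewrite orbT.
- by move=> n; exists n%:R.
- apply/seteqP; split => // y _; exists (Num.truncn `|y|).+1 => //=.
  rewrite /r /= in_itv/= ratr_nat (le_lt_trans (ler_norm _))//.
  by rewrite truncnS_gt.
- by move=> _ [q ->].
- move=> n; apply: (le_lt_trans _ m1oo); apply: le_measure; rewrite ?inE//.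
  exact: measurable_itv.
Qed.

End measure_facts.

Section unif.
Context {R : realType}.

(* The copy of [uniform_prob] living on [R] with its default display. *)
Definition unif : set R -> \bar R := uniform_prob (@ltr01 R).

Let unif_ge0 U : 0 <= unif U.
Proof. exact: (measure_ge0 (uniform_prob (@ltr01 R))). Qed.

Let unif_sigma_additive : semi_sigma_additive unif.
Proof. exact: (@measure_semi_sigma_additive _ _ _ (uniform_prob (@ltr01 R))). Qed.

HB.instance Definition _ := isMeasure.Build _ R R unif
  (measure0 (uniform_prob (@ltr01 R))) unif_ge0 unif_sigma_additive.

HB.instance Definition _ := Measure_isProbability.Build _ R R unif
  (probability_setT (uniform_prob (@ltr01 R))).

End unif.

Section uniform.
Context {R : realType}.
Local Notation unif := (@unif R).

(** The half-open interval drops the null point 0, where the infimum defining the quantile would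
    range over all rationals. *)
Lemma unifE (U : set R) : measurable U -> unif U = lebesgue_measure (U `&` `]0%R, 1%R]%classic).
Proof.
move=> mU; rewrite /unif /= /uniform_prob integral_uniform_pdf.
rewrite (eq_integral (fun=> 1)); last first.
  by move=> x /[!inE] -[_]; rewrite /= in_itv/= /uniform_pdf => ->;
    rewrite subr0 invr1.
rewrite integral_cst ?mul1e//; last exact: measurableI.
have -> : `[0%R, 1%R]%classic = [set 0%R] `|` `]0%R, 1%R]%classic :> set R.
  by rewrite setU1itv// bnd_simp.
rewrite setIUr measureU//; [|exact: measurableI|exact: measurableI|].
  rewrite [X in X + _](_ : _ = 0) ?add0e//; apply/eqP.
  rewrite -measure_le0 -(lebesgue_measure_set1 (0%R : R)).
  by apply: le_measure; rewrite ?inE//; exact: measurableI.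
apply/seteqP; split => // x [[_ ->] [_]] /=.
by rewrite in_itv/= ltxx.
Qed.

Lemma unif_le (p : R) : (0 <= p <= 1)%R -> unif [set u | (u <= p)%R] = p%:E.
Proof.
move=> /andP[p0 p1]; have -> : [set u | (u <= p)%R] = `]-oo, p]%classic by rewrite set_itvE.
rewrite unifE//.
rewrite (_ : _ `&` _ = `]0%R, p]%classic); last first.
  apply/seteqP; split => x /=; rewrite !in_itv/=; first by move=> [-> /andP[->]].
  by move=> /andP[-> xp]; rewrite xp (le_trans xp).
by rewrite lebesgue_measure_itv/= lte_fin; case: ltP => [|p0'];
  rewrite ?oppr0 ?adde0//; congr EFin; lra.
Qed.

(* [u] is the uniform variable; [fine] matters only for [u = 0]. *)
Definition quantile (F : rat -> R) (u : R) : R :=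
  fine (inf_rat [set q | (u <= F q)%R]).

Lemma quantile_lt (F : rat -> R) (t : rat) (u : R) :
  (forall q, (q < 0)%R -> F q = 0%R) -> (forall q, (1 <= q)%R -> F q = 1%R) ->
  (0 < u <= 1)%R ->
  (quantile F u < ratr t)%R <-> exists2 q, (u <= F q)%R & (q < t)%R.
Proof.
move=> F0 F1 /andP[u0 u1]; rewrite -lte_fin fineK.
  by rewrite inf_rat_lt; split => -[q ? qt]; exists q => //; rewrite ltr_rat in qt *.
rewrite fin_numElt; apply/andP; split.
  apply: (@lt_le_trans _ _ 0); first exact: ltNyr.
  apply: le_ereal_inf_tmp => _ [q /= uq <-]; rewrite lee_fin ler0q leNgt.
  by apply/negP => /F0 Fq; move: uq; rewrite Fq leNgt u0.
apply: (@le_lt_trans _ _ 1); last exact: ltry.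
apply: ereal_inf_lbound; exists 1%R => //=; first by rewrite F1.
by rewrite rmorph1.
Qed.

Lemma measurable_quantile d (T : measurableType d) (F : T -> rat -> R) :
  (forall q, measurable_fun setT (F ^~ q)) ->
  measurable_fun setT (fun p : T * R => quantile (F p.1) p.2).
Proof.
move=> mF; apply: (measurableT_comp (fine_measurable measurableT)).
apply: (@measurable_inf_rat R _ _ (fun q => [set p : T * R | (p.2 <= F p.1 q)%R])) => q.
have mFq : measurable_fun setT (fun p : T * R => F p.1 q).
  exact: (measurableT_comp (mF q) measurable_fst).
have := @measurable_fun_ler _ _ R setT _ _ measurable_snd mFq measurableT [set true] (ltac:(by [])).
by rewrite setTI.
Qed.

(** For the quantile to be below t, one needs u <= F q at some rational q < t; the probability is
    thus the left limit of F at t. Using strict half-lines allows any nondecreasing F, without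
    one-sided continuity. *)
Lemma cvg_unif_quantile (F : rat -> R) (t : rat) :
  {homo F : q r / (q <= r)%R} ->
  (forall q, (q < 0)%R -> F q = 0%R) -> (forall q, (1 <= q)%R -> F q = 1%R) ->
  (F (t - n.+1%:R^-1)%R)%:E @[n --> \oo] --> unif [set u | (quantile F u < ratr t)%R].
Proof.
move=> ndF F0 F1.
pose G n := [set u : R | (u <= F (t - n.+1%:R^-1))%R].
have F01 q : (0 <= F q <= 1)%R.
  apply/andP; split.
    by rewrite -(F0 (Order.min q (-1))%R) ?gt_min ?ltrN10 ?orbT// ndF// ge_min lexx.
  by rewrite -(F1 (Order.max q 1)%R) ?le_max ?lexx ?orbT// ndF// le_max lexx.
have mG n : measurable (G n).
  by rewrite /G -set_itvNyc.
have mQ : measurable [set u | (quantile F u < ratr t)%R].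
  have := @measurable_quantile _ unit (fun _ => F) (fun q => @measurable_cst _ _ _ _ setT (F q)).
  move=> /(measurable_fun_pair2 tt)/= mq.
  have := @measurable_fun_ltr _ _ R setT _ _ mq (@measurable_cst _ _ _ _ setT (ratr t : R)) measurableT [set true] (ltac:(by [])).
  by rewrite setTI.
have -> : unif [set u | (quantile F u < ratr t)%R] = unif (\bigcup_n G n).
  rewrite !unifE//; last exact: bigcupT_measurable.
  congr (lebesgue_measure _); apply/seteqP; split => u /= [];
    rewrite in_itv/= => h u01;
    split => //.
    move: h => /(quantile_lt t F0 F1 u01)[q uq qt].
    have tq : (0 < t - q)%R by lra.
    (* With this n, n + 1 exceeds 1 / (t - q), hence q <= t - 1 / (n + 1). *)
    exists (Num.truncn (t - q)^-1) => //=; apply: (le_trans uq); apply: ndF.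
    rewrite lerBrDr -lerBrDl -[leRHS]invrK lef_pV2 ?posrE ?invr_gt0//.
    by rewrite ltW// truncnS_gt.
  apply/(quantile_lt t F0 F1 u01); case: h => n _ /= uF.
  exists (t - n.+1%:R^-1)%R => //; by rewrite ltrBlDr ltrDl invr_gt0.
have -> : (fun n => (F (t - n.+1%:R^-1)%R)%:E) = unif \o G.
  by apply/funext => n /=; rewrite unif_le.
apply: nondecreasing_cvg_mu => //; first exact: bigcupT_measurable.
move=> m n mn; apply/subsetPset => u /= /le_trans; apply; apply: ndF.
by rewrite lerB// lef_pV2 ?posrE// ler_nat.
Qed.

End uniform.

Section randomization.
Context {R : realType}.

Lemma measurable_fun_section d1 d2 d3 (T1 : measurableType d1)
    (T2 : measurableType d2) (T3 : measurableType d3) (f : T1 * T2 -> T3) x :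
  measurable_fun setT f -> measurable_fun setT (fun y => f (x, y)).
Proof. exact: measurable_fun_pair2. Qed.

Lemma measurable_preim d1 d2 (T1 : measurableType d1) (T2 : measurableType d2)
    (f : T1 -> T2) (U : set T2) :
  measurable_fun setT f -> measurable U -> measurable (f @^-1` U).
Proof. by move=> mf mU; rewrite -[X in measurable X]setTI; exact: mf. Qed.

Lemma itv_lt_bigcup (t : rat) :
  `]-oo, (ratr t : R)[%classic =
  \bigcup_n `]-oo, (ratr (t - n.+1%:R^-1)%R : R)]%classic.
Proof.
apply/seteqP; split => x /=; rewrite in_itv/=.
  move=> xt; have [q] := rat_in_itvoo xt; rewrite in_itv/= => /andP[xq].
  rewrite ltr_rat => qt; have tq : (0 < t - q)%R by lra.
  exists (Num.truncn (t - q)^-1) => //=; rewrite in_itv/=;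
    apply: (le_trans (ltW xq)).
  rewrite ler_rat lerBrDr -lerBrDl -[leRHS]invrK lef_pV2 ?posrE ?invr_gt0//.
  by rewrite ltW// truncnS_gt.
move=> [n _] /=; rewrite in_itv/= => /le_lt_trans; apply.
by rewrite ltr_rat ltrBlDr ltrDl invr_gt0.
Qed.

Lemma nondecreasing_itv_le (t : rat) :
  nondecreasing_seq (fun n => `]-oo, (ratr (t - n.+1%:R^-1)%R : R)]%classic).
Proof.
move=> m n mn; apply/subsetPset => x /=; rewrite !in_itv/= => /le_trans; apply.
by rewrite ler_rat lerB// lef_pV2 ?posrE// ler_nat.
Qed.

(** Carry [k y] into [0, 1] by [s], take the quantile function of its distribution function, which
    is measurable jointly in y and u, and return by [g]. The two laws are compared on rational
    half-lines. *)
Lemma randomization d d' (Y : measurableType d) (B : measurableType d')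
    (k : Y -> {measure set B -> \bar R}) :
  @real_retract R _ B -> (forall y, k y setT = 1) ->
  (forall U, measurable U -> measurable_fun setT (k ^~ U)) ->
  exists2 xi : Y * R -> B, measurable_fun setT xi &
    forall y U, measurable U -> k y U = unif [set u | U (xi (y, u))].
Proof.
move=> /real_retract01[s [g [ms mg sg s01]]] k1 mk.
pose D (q : rat) := s @^-1` `]-oo, ratr q]%classic.
have mD q : measurable (D q) by apply: measurable_preim.
pose F y q := fine (k y (D q)).
have kfin y U : measurable U -> k y U \is a fin_num.
  move=> mU; rewrite ge0_fin_numE//; apply: (@le_lt_trans _ _ (k y setT)).
    by apply: le_measure; rewrite ?inE.
  by rewrite k1 ltry.
have mF q : measurable_fun setT (F ^~ q).
  exact: (measurableT_comp (fine_measurable measurableT) (mk _ (mD q))).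
have ndF y : {homo F y : q r / (q <= r)%R}.
  move=> q r qr; apply: fine_le; [exact: kfin|exact: kfin|].
  apply: le_measure; rewrite ?inE// => b; rewrite /D /= !in_itv/= => /le_trans.
  by apply; rewrite ler_rat.
have F0 y q : (q < 0)%R -> F y q = 0%R.
  move=> q0; rewrite /F (_ : D q = set0) ?measure0//.
  apply/seteqP; split => // b; rewrite /D /= in_itv/= => sq.
  have /andP[s0 _] := s01 b.
  have : (ratr q < 0 :> R)%R by rewrite ltrq0.
  by move/(le_lt_trans sq); rewrite ltNge s0.
have F1 y q : (1 <= q)%R -> F y q = 1%R.
  move=> q1; rewrite /F (_ : D q = setT) ?k1//.
  apply/seteqP; split => // b _; rewrite /D /= in_itv/=.
  have /andP[_ /le_trans] := s01 b; apply.
  by rewrite -(rmorph1 (ratr : rat -> R)) ler_rat.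
pose Q (p : Y * R) := quantile (F p.1) p.2.
have mQ : measurable_fun setT Q by exact: measurable_quantile.
exists (g \o Q); first exact: measurableT_comp.
move=> y U mU.
have mQy := measurable_fun_section y mQ.
have := @real_measure_unique R (image_measure (k y) ms) (image_measure unif mQy).
move=> /(_ _ _ (g @^-1` U)) h.
transitivity (k y (s @^-1` (g @^-1` U))).
  by congr (k y _); apply/funext => b /=; rewrite sg.
rewrite -image_measureE h//; last exact: measurable_preim.
  by rewrite image_measureE preimage_setT k1 ltry.
move=> t; set I := (`]-oo, _[)%classic.
suff : k y (s @^-1` I) = unif ((fun u => Q (y, u)) @^-1` I) by [].
rewrite {}/I.
have -> : (fun u => Q (y, u)) @^-1` `]-oo, ratr t[%classic =
    [set u | (quantile (F y) u < ratr t)%R].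
  by apply/funext => u /=; rewrite in_itv.
have /cvg_lim <- // := @cvg_unif_quantile R (F y) t (@ndF y) (@F0 y) (@F1 y).
apply/esym/cvg_lim => //; rewrite itv_lt_bigcup preimage_bigcup.
have -> : (fun n => (F y (t - n.+1%:R^-1)%R)%:E) = k y \o (fun n => D (t - n.+1%:R^-1)%R).
  by apply/funext => n /=; rewrite fineK// kfin.
apply: nondecreasing_cvg_mu => //; first exact: bigcupT_measurable.
move=> m n /(@nondecreasing_itv_le t)/subsetPset mn.
by apply/subsetPset; exact: preimage_subset.
Qed.

(** The randomization of a constant kernel whose target is the plane, itself a retract of the
    line. *)
Lemma unif_splitting : exists2 T : R -> R * R, measurable_fun setT T &
  forall G, measurable G -> unif (T @^-1` G) = (unif \x unif) G.
Proof.
have := @randomization _ _ unit (R * R)%type (fun=> (unif \x unif : {measure set _ -> \bar R})).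
case.
- exact: real_retract_RR.
- move=> _; have := @product_measure1E _ _ _ _ R unif unif setT setT measurableT measurableT.
  rewrite setXTT => h; apply: (etrans h).
  by rewrite -[RHS]mule1; congr (_ * _); exact: probability_setT.
- by move=> U mU; exact: measurable_cst.
move=> xi mxi h; exists (fun u => xi (tt, u)); first exact: measurable_fun_section.
by move=> G mG; rewrite (h tt).
Qed.

End randomization.

(** * Disintegration *)

Section disintegration.
Context {R : realType}.

Lemma radon_nikodym_measure d (T : measurableType d)
    (mu nu : {measure set T -> \bar R}) :
  mu setT < +oo -> (forall E, measurable E -> nu E <= mu E) ->
  exists f : T -> \bar R, [/\ forall x, 0 <= f x, mu.-integrable setT f &
    forall E, measurable E -> nu E = \int[mu]_(x in E) f x].
Proof.
move=> muoo numu.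
have nuoo : nu setT < +oo by exact: le_lt_trans (numu _ measurableT) muoo.
have mu'E : (mfrestr measurableT muoo : set T -> \bar R) = mu.
  by apply/funext => U; rewrite /= /mfrestr /mrestr setIT.
have nu'E : (mfrestr measurableT nuoo : set T -> \bar R) = nu.
  by apply/funext => U; rewrite /= /mfrestr /mrestr setIT.
have [|f [f0 fi fE]] :=
    @radon_nikodym_finite _ _ _ (mfrestr measurableT muoo) (mfrestr measurableT nuoo).
  apply/null_content_dominatesP => E mE; rewrite /= /mfrestr /mrestr !setIT => muE0.
  by apply/eqP; rewrite -measure_le0; have := numu E mE; rewrite muE0.
exists f; split => //; first by rewrite -mu'E.
by move=> E mE; rewrite -nu'E -mu'E; exact: fE.
Qed.

(** The functions g and max(g, f) have equal integrals over every measurable set, as one sees by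
    cutting the set along g < f; hence they agree almost everywhere. *)
Lemma ae_le_of_integral_le d (T : measurableType d) (m : {measure set T -> \bar R})
    (f g : T -> \bar R) :
  measurable_fun setT f -> m.-integrable setT g ->
  (forall x, 0 <= f x) -> (forall x, 0 <= g x) ->
  (forall E, measurable E -> \int[m]_(x in E) f x <= \int[m]_(x in E) g x) ->
  {ae m, forall x, f x <= g x}.
Proof.
move=> mf ig f0 g0 fg; have mg := measurable_int _ ig.
pose h x := maxe (g x) (f x).
have mh : measurable_fun setT h by exact: measurable_maxe.
have : ae_eq m setT g h.
  apply: integral_ae_eq => // E _ mE; apply/eqP; rewrite eq_le; apply/andP; split.
    apply: ge0_le_integral => //; [exact: measurable_funTS|exact: measurable_funTS|].
    by move=> x _; rewrite /h le_max lexx.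
  pose A := [set x | g x < f x].
  have mA : measurable A.
    by have := measurable_lte measurableT mg mf; rewrite setTI.
  have EA : E = (E `&` A) `|` (E `\` A) by rewrite setUIDK.
  have mEA := measurableI _ _ mE mA; have mEA' := measurableD mE mA.
  have dis : [disjoint E `&` A & E `\` A].
    by apply/disj_setPS => x [[_ Ax] [_ nAx]].
  rewrite {1 2}EA !ge0_integral_setU//; try exact: measurable_funTS;
    try by move=> x _; rewrite ?le_max ?g0.
  apply: leeD.
    rewrite (eq_integral f); first exact: fg.
    by move=> x /[!inE] -[_ /ltW gf]; rewrite /h; apply/max_idPr.
  rewrite (eq_integral g)// => x /[!inE] -[_ /negP]; rewrite -leNgt => fgx.
  by rewrite /h; apply/max_idPl.
apply: filterS => x /(_ I); rewrite /h => ->.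
by rewrite le_max lexx orbT.
Qed.

(** Radon-Nikodym gives, for each rational q, the conditional probability [H q] of s <= q. Off one
    null set these are nondecreasing in q and at most 1, that is, a conditional distribution
    function, whose quantile function is the required [xi]. *)
Lemma finite_disintegration d d' (T : measurableType d) (B : measurableType d')
    (mu : {measure set (T * B) -> \bar R}) (m : {measure set T -> \bar R}) :
  (forall E, measurable E -> m E = mu (E `*` setT)) ->
  @real_retract R _ B -> mu setT < +oo ->
  exists2 xi : T * R -> B, measurable_fun setT xi &
    forall G, measurable G ->
      mu G = \int[m]_x unif [set u | G (x, xi (x, u))].
Proof.
move=> mE /real_retract01[s [g [ms mg sg s01]]] muoo.
have moo : m setT < +oo by rewrite mE// setXTT.
pose D (q : rat) := [set p : T * B | (s p.2 <= ratr q)%R].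
have mD q : measurable (D q).
  have := @measurable_fun_ler _ _ R setT _ _ (measurableT_comp ms measurable_snd)
    (@measurable_cst _ _ (T * B)%type R setT (ratr q)) measurableT [set true] (ltac:(by [])).
  by rewrite setTI.
have mX (E : set T) : measurable E -> measurable (E `*` [set: B]) by move=> mE';
  exact: measurableX.
have ex q := @radon_nikodym_measure _ _ m (image_measure (mrestr mu (mD q)) measurable_fst) moo.
have {ex} /choice[H HP] : forall q, exists f : T -> \bar R,
   [/\ forall x, 0 <= f x, m.-integrable setT f & forall E, measurable E ->
     mu ((E `*` setT) `&` D q) = \int[m]_(x in E) f x].
  have fstE E : fst @^-1` E = E `*` setT :> set (T * B).
    by apply/seteqP; split => [[x b]|[x b] []].
  move=> q; have [|f [f0 fi fE]] := ex q.
    move=> E mE'; rewrite mE//.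
    suff : mu (fst @^-1` E `&` D q) <= mu (E `*` setT) by [].
    rewrite fstE; apply: le_measure; rewrite ?inE; last exact: subIsetl.
    - by apply: measurableI => //; exact: mX.
    - exact: mX.
  by exists f; split => // E mE'; rewrite -fE// -fstE.
have H0 q : forall x, 0 <= H q x by have [] := HP q.
have Hi q : m.-integrable setT (H q) by have [] := HP q.
have HE q E : measurable E -> mu ((E `*` setT) `&` D q) = \int[m]_(x in E) H q x.
  by have [_ _] := HP q; exact.
have mH q := measurable_int _ (Hi q).
have aemono : {ae m, forall x, forall q r, (q <= r)%R -> H q x <= H r x}.
  suff : {ae m, forall x, forall n : nat, if @unpickle (rat * rat)%type n is Some p
      then (p.1 <= p.2)%R -> H p.1 x <= H p.2 x else True}.
    by apply: filterS => x h q r; have := h (pickle (q, r)); rewrite pickleK.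
  apply: ae_foralln => n; case: unpickle => [[q r]/=|]; last exact: filterE.
  case: (boolP (q <= r)%R) => qr; last exact: filterE.
  suff : {ae m, forall x, H q x <= H r x} by apply: filterS.
  apply: ae_le_of_integral_le => // E mE'; rewrite -!HE//; apply: le_measure;
    rewrite ?inE.
  - by apply: measurableI => //; exact: mX.
  - by apply: measurableI => //; exact: mX.
  - apply: setIS => p; rewrite /D /= => /le_trans; apply; by rewrite ler_rat.
have ae1 : {ae m, forall x, forall q, H q x <= 1}.
  suff : {ae m, forall x, forall n : nat, if @unpickle rat n is Some q
      then is_true (H q x <= 1) else True}.
    by apply: filterS => x h q; have := h (pickle q); rewrite pickleK.
  apply: ae_foralln => n; case: unpickle => [q/=|]; last exact: filterE.
  apply: ae_le_of_integral_le => //.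
    apply/integrableP; split; first exact: measurable_cst.
    by under eq_integral do rewrite abse1; rewrite integral_cst// mul1e.
  move=> E mE'; rewrite -HE// integral_cst// mul1e mE//; apply: le_measure;
    rewrite ?inE.
  - by apply: measurableI => //; exact: mX.
  - exact: mX.
  - exact: subIsetl.
(* The values outside [0, 1[ are forced, so that the boundary conditions of [quantile_lt] hold for
   every x; only monotonicity is left to almost every x. *)
pose F x (q : rat) : R := if (q < 0)%R then 0%R else if (1 <= q)%R then 1%R else fine (H q x).
have mF q : measurable_fun setT (F ^~ q).
  rewrite /F; case: (q < 0)%R; first exact: measurable_cst.
  case: (1 <= q)%R; first exact: measurable_cst.
  exact: (measurableT_comp (fine_measurable measurableT)).
have F0 x q : (q < 0)%R -> F x q = 0%R by rewrite /F => ->.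
have F1 x q : (1 <= q)%R -> F x q = 1%R.
  by rewrite /F => q1; rewrite ltNge (le_trans ler01 q1) q1.
have aeF : {ae m, forall x, {homo F x : q r / (q <= r)%R}}.
  apply: filterS2 aemono ae1 => x mono le1 q r qr.
  have Hfin p : H p x \is a fin_num.
    by rewrite ge0_fin_numE// (le_lt_trans (le1 p))// ltry.
  rewrite /F; case: (ltP q 0%R) => q0.
    case: ifP => // _; case: ifP => // _; exact: fine_ge0.
  rewrite ltNge (le_trans q0 qr)/=.
  case: (leP 1%R q) => q1; first by rewrite (le_trans q1 qr).
  case: ifP => _; first by rewrite -lee_fin fineK.
  by apply: fine_le => //; exact: mono.
have FE q E : measurable E -> \int[m]_(x in E) (F x q)%:E = mu ((E `*` setT) `&` D q).
  move=> mE'; rewrite /F; case: (boolP (q < 0)%R) => [q0|q0].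
    rewrite integral0 (_ : _ `&` _ = set0) ?measure0//.
    apply/seteqP; split => // -[x b] [_] /=; rewrite /D /= => sq.
    have /andP[s0 _] := s01 b; have : (ratr q < 0 :> R)%R by rewrite ltrq0.
    by move/(le_lt_trans sq); rewrite ltNge s0.
  case: (boolP (1 <= q)%R) => q1.
    rewrite integral_cst// mul1e mE//; congr (mu _); apply/seteqP;
      split => [[x b] Ex|[x b] [[]]//].
    split; first exact: Ex.
    have /andP[_ sb] := s01 b; apply: (le_trans sb).
    by rewrite -(rmorph1 (ratr : rat -> R)) ler_rat.
  rewrite HE//; apply: ge0_ae_eq_integral => //.
  - by apply/measurable_EFinP; apply: measurable_funTS;
      exact: (measurableT_comp (fine_measurable measurableT)).
  - exact: measurable_funTS.
  - by move=> x _; rewrite lee_fin fine_ge0.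
  - apply: filterS ae1 => x le1 _; rewrite fineK//.
    by rewrite ge0_fin_numE// (le_lt_trans (le1 q))// ltry.
pose Q (p : T * R) := quantile (F p.1) p.2.
have mQ : measurable_fun setT Q by exact: measurable_quantile.
have mQlt t : measurable [set p : T * R | (Q p < ratr t)%R].
  have := @measurable_fun_ltr _ _ R setT _ _ mQ
    (@measurable_cst _ _ (T * R)%type R setT (ratr t)) measurableT [set true] (ltac:(by [])).
  by rewrite setTI.
have mUQ t : measurable_fun setT (fun x => unif [set u | (Q (x, u) < ratr t)%R]).
  have := measurable_fun_xsection (unif : {measure set R -> \bar R}) (mQlt t).
  by apply: eq_measurable_fun => x _ /=; congr unif; apply/seteqP; split => u;
     rewrite /xsection /= inE.
(* Passage from the closed half-lines of [D] to open ones: dominated convergence along t - 1 / (n +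
   1), with the constant 1 as bound, integrable because m is finite. *)
have key t E : measurable E ->
    \int[m]_(x in E) unif [set u | (Q (x, u) < ratr t)%R] =
    mu ((E `*` setT) `&` [set p | (s p.2 < ratr t)%R]).
  move=> mE'; pose tn n := (t - n.+1%:R^-1)%R.
  have mf_ n : measurable_fun E (fun x => (F x (tn n))%:E).
    by apply/measurable_EFinP; exact: measurable_funTS.
  have mf : measurable_fun E (fun x => unif [set u | (Q (x, u) < ratr t)%R]).
    exact: measurable_funTS.
  have i1 : m.-integrable E (cst 1).
    apply/integrableP; split; first exact: measurable_cst.
    under eq_integral do rewrite abse1.
    rewrite integral_cst// mul1e; apply: le_lt_trans moo.
    by apply: le_measure; rewrite ?inE.
  have [||_ _ h] := dominated_convergence mE' mf_ mf _ i1.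
  - apply: filterS aeF => x ndF _.
    exact: (@cvg_unif_quantile R (F x) t ndF (@F0 x) (@F1 x)).
  - apply: filterS aeF => x ndF n _; rewrite /= lee_fin ger0_norm.
      rewrite -(F1 x (Order.max (tn n) 1%R)) ?le_max ?lexx ?orbT//.
      by apply: ndF; rewrite le_max lexx.
    rewrite -(F0 x (Order.min (tn n) (-1)%R)) ?gt_min ?ltrN10 ?orbT//.
    by apply: ndF; rewrite ge_min lexx.
  rewrite -(cvg_lim _ h)//; apply/cvg_lim => //.
  have -> : (fun n => \int[m]_(x in E) (F x (tn n))%:E) =
      mu \o (fun n => (E `*` setT) `&` D (tn n)).
    by apply/funext => n /=; rewrite FE.
  have -> : (E `*` setT) `&` [set p : T * B | (s p.2 < ratr t)%R] =
      \bigcup_n ((E `*` setT) `&` D (tn n)).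
    rewrite -setI_bigcupr; congr (_ `&` _).
    have -> : [set p : T * B | (s p.2 < ratr t)%R] =
        (fun p => s p.2) @^-1` `]-oo, ratr t[%classic.
      by apply/funext => p /=; rewrite in_itv.
    rewrite itv_lt_bigcup preimage_bigcup; apply: eq_bigcupr => n _.
    by apply/funext => p; rewrite /D /= in_itv.
  apply: nondecreasing_cvg_mu.
  - by move=> n; apply: measurableI => //; exact: mX.
  - by apply: bigcupT_measurable => n; apply: measurableI => //; exact: mX.
  - move=> i j ij; apply/subsetPset; apply: setIS => p.
    by have /subsetPset/(_ (s p.2)) := @nondecreasing_itv_le R t i j ij;
      rewrite /= !in_itv.
have msnd : measurable_fun setT (fun p : T * B => s p.2).
  exact: (measurableT_comp ms measurable_snd).
have m1 : measurable_fun setT (fun p : T * B => (p.1, s p.2)).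
  by apply: measurable_fun_pair.
have m2 : measurable_fun setT (fun p : T * R => (p.1, Q p)).
  by apply: measurable_fun_pair.
(* The identity is first proved with the second coordinate read in the line through [s]: on
   rectangles, and for a fixed base E on half-lines, which is [key]. Applying [g] afterwards gives
   it on B. *)
have law_eq (S : set (T * R)) : measurable S ->
    mu ((fun p : T * B => (p.1, s p.2)) @^-1` S) =
    (m \x unif) ((fun p : T * R => (p.1, Q p)) @^-1` S).
  apply: (@measure_unique_rectangles R _ _ T R (image_measure mu m1)
    (image_measure (m \x unif) m2)) => //.
  move=> E U mE' mU.
  have mXR : measurable (E `*` [set: R]) by exact: measurableX.
  have := @real_measure_unique R (image_measure (mrestr mu (mX E mE')) msnd)
    (image_measure (mrestr (m \x unif) mXR) mQ).
  move=> /(_ _ _ U mU) h.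
  suff : mu ((fun p : T * B => s p.2) @^-1` U `&` (E `*` setT)) =
         (m \x unif) (Q @^-1` U `&` (E `*` setT)).
    congr (mu _ = (m \x unif) _).
      by apply/seteqP; split => [[x b]/= [? []]|[x b]/= [? ?]].
    by apply/seteqP; split => [[x b]/= [? []]|[x b]/= [? ?]].
  apply: h.
    suff : mu (setT `&` (E `*` setT)) < +oo by [].
    rewrite setTI; apply: le_lt_trans muoo; apply: le_measure; rewrite ?inE//.
    exact: mX.
  move=> t.
  suff : mu ((fun p : T * B => s p.2) @^-1` `]-oo, ratr t[%classic `&` (E `*` setT)) =
         (m \x unif) (Q @^-1` `]-oo, ratr t[%classic `&` (E `*` setT)) by [].
  rewrite setIC.
  have -> : (fun p : T * B => s p.2) @^-1` `]-oo, ratr t[%classic =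
    [set p | (s p.2 < ratr t)%R] by apply/funext => p /=; rewrite in_itv.
  rewrite -key// integral_mkcond /product_measure1.
  apply: eq_integral => x _; rewrite patchE /=; case: ifPn => xE.
    congr (unif _); apply/seteqP; split => u /=; rewrite xsectionE /= in_itv/=.
      by move=> ?; split => //; split => //; exact: set_mem.
    by case.
  rewrite (_ : xsection _ _ = set0) ?measure0//.
  apply/seteqP; split => // u; rewrite xsectionE /= => -[_ [/= Ex _]].
  by move: xE; rewrite mem_set.
exists (fun p => g (Q p)); first exact: (measurableT_comp mg mQ).
move=> G mG.
have mgg : measurable_fun setT (fun p : T * R => (p.1, g p.2)).
  by apply: measurable_fun_pair => //; exact: (measurableT_comp mg measurable_snd).
have := law_eq ((fun p : T * R => (p.1, g p.2)) @^-1` G) (measurable_preim mgg mG).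
rewrite (_ : _ @^-1` _ = G); last by apply/funext => -[x b] /=; rewrite sg.
move=> ->; rewrite /product_measure1; apply: eq_integral => x _ /=.
by rewrite xsectionE.
Qed.

End disintegration.

Section noise_kernel.
Context {R : realType} d d' (T : measurableType d) (B : measurableType d').
Variables (xi : T * R -> B) (mxi : measurable_fun setT xi).

Definition noise_kernel (x : T) : {measure set B -> \bar R} :=
  image_measure (@unif R) (measurable_fun_section x mxi).

Let measurable_noise_kernel U : measurable U ->
  measurable_fun setT (noise_kernel ^~ U).
Proof.
move=> mU; have := measurable_fun_xsection (@unif R) (measurable_preim mxi mU).
by apply: eq_measurable_fun => x _ /=; rewrite xsectionE.
Qed.

HB.instance Definition _ := isKernel.Build _ _ _ _ R noise_kernel measurable_noise_kernel.

Let noise_kernel_prob x : noise_kernel x setT = 1.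
Proof. exact: (probability_setT (@unif R)). Qed.

HB.instance Definition _ := Kernel_isProbability.Build _ _ _ _ R
  noise_kernel noise_kernel_prob.

End noise_kernel.

Section sigma_finite_disintegration.
Context {R : realType}.

(** Make the sets disjoint, disintegrate over each piece, and let the piece containing x choose the
    noise function. Nothing is claimed off the union, where mu may be far from sigma-finite. *)
Lemma sigma_finite_disintegration d d' (T : measurableType d)
    (B : measurableType d') (mu : {measure set (T * B) -> \bar R})
    (F : nat -> set T) :
  @real_retract R _ B ->
  (forall n, measurable (F n)) -> (forall n, mu (F n `*` setT) < +oo) ->
  exists k : R.-pker T ~> B, forall G, measurable G ->
    G `<=` (\bigcup_n F n) `*` setT ->
    mu G = \int[pushforward mu fst]_(x in \bigcup_n F n) k x (xsection G x).
Proof.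
move=> rB mF Foo; pose D := seqDU F.
have mD n : measurable (D n) by exact: seqDU_measurable.
have mX (E : set T) : measurable E -> measurable (E `*` [set: B]).
  by move=> mE; exact: measurableX.
have Doo n : mu (D n `*` setT) < +oo.
  apply: le_lt_trans (Foo n); apply: le_measure; rewrite ?inE; try exact: mX.
  by move=> [x b] [/= Dx _]; split => //; exact: subset_seqDU Dx.
pose m : {measure set T -> \bar R} := image_measure mu measurable_fst.
have mE E : m E = mu (E `*` setT).
  rewrite -[LHS]/(mu (fst @^-1` E)); congr (mu _).
  by apply/seteqP; split => [[x b]|[x b] []].
have ex n : exists2 xi : T * R -> B, measurable_fun setT xi &
    forall G, measurable G -> G `<=` D n `*` setT ->
      mu G = \int[m]_(x in D n) unif [set u | G (x, xi (x, u))].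
  have [|| xi mxi xiE] := @finite_disintegration R _ _ T B (mrestr mu (mX _ (mD n)))
    (mrestr m (mD n)) _ rB.
  - move=> E mE'; rewrite -[LHS]/(m (E `&` D n)) mE /mrestr; congr (mu _).
    by apply/seteqP; split => [[x b] [[]]|[x b] [[? _] []]].
  - by rewrite -[X in X < _]/(mu (setT `&` _)) setTI.
  exists xi => // G mG GD; have := xiE G mG.
  rewrite -[X in X = _ -> _]/(mu (G `&` _)) (setIidl GD) => ->.
  transitivity (\int[mrestr m (mD n)]_(x in D n) unif [set u | G (x, xi (x, u))]).
    rewrite [RHS]integral_mkcond; apply: eq_integral => x _; rewrite patchE.
    case: ifPn => // xD; rewrite (_ : [set _ | _] = set0) ?measure0//.
    apply/seteqP; split => // u /= /GD[/= Dx _].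
    by move: xD; rewrite mem_set.
  by apply: eq_measure_integral => A mA AD; rewrite -[LHS]/(m (A `&` D n)) setIidl.
have {ex} /choice[xi xiP] : forall n, exists xi : T * R -> B, measurable_fun setT xi /\
    forall G, measurable G -> G `<=` D n `*` setT ->
      mu G = \int[m]_(x in D n) unif [set u | G (x, xi (x, u))].
  by move=> n; have [xi mxi ?] := ex n; exists xi.
(* Points off the union get the default index 0. Hence only the preimages of positive indices are
   exactly pieces, and that of 0 is handled as a complement. *)
pose idx x := xget 0%N [set n | D n x].
have idxE n x : D n x -> idx x = n.
  move=> Dnx; rewrite /idx; apply: xget_unique => // k Dkx.
  by apply: (@trivIset_seqDU _ F k n) => //; exists x.
pose Xi (p : T * R) := xi (idx p.1) p.
have mXi : measurable_fun setT Xi.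
  have idxS n : idx @^-1` [set n.+1] = D n.+1.
    apply/seteqP; split => x; last exact: idxE.
    rewrite /idx /= => xn; have := xn; case: xgetP => // y ->.
    by move=> Dy yn; rewrite -yn.
  have midx n : measurable (idx @^-1` [set n]).
    case: n => [|n]; last by rewrite idxS.
    rewrite (_ : _ @^-1` _ = ~` \bigcup_n (idx @^-1` [set n.+1])).
      by apply: measurableC; apply: bigcupT_measurable => n; rewrite idxS.
    apply/seteqP; split => x /=; first by move=> x0 [n _] /=; rewrite x0.
    case xn : (idx x) => [//|n] h; exfalso; apply: h.
    by exists n.
  move=> _ U mU; rewrite setTI.
  rewrite (_ : _ @^-1` _ = \bigcup_n ((idx @^-1` [set n] `*` setT) `&` xi n @^-1` U)).
    apply: bigcupT_measurable => n; apply: measurableI; first exact: measurableX.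
    by have [mxi _] := xiP n; exact: measurable_preim.
  apply/seteqP; split => [[x u] /= Uxi|[x u] [n _] [[/= <- _]]//].
  by exists (idx x) => //.
exists (noise_kernel mXi) => G mG GV.
rewrite -[pushforward _ _]/(m : set T -> \bar R).
rewrite seqDU_bigcup_eq -/D in GV *.
rewrite ge0_integral_bigcup//.
- transitivity (\sum_(0 <= n <oo) mu (G `&` (D n `*` setT))).
    rewrite -{1}(setIidl GV) setX_bigcupl setI_bigcupr measure_bigcup//.
    - by apply: eq_eseriesl => n; rewrite in_setT.
    - by move=> n _; apply: measurableI => //; exact: mX.
    - move=> i j _ _ [[x b] [[_ [Di _]] [_ [Dj _]]]].
      by apply: (@trivIset_seqDU _ F i j) => //; exists x.
  apply: eq_eseriesr => n _; have [mxi xiE] := xiP n.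
  rewrite xiE//.
  + apply: eq_integral => x; rewrite inE => Dx; congr (unif _).
    apply/seteqP; split => u /=; rewrite /xsection/= inE /Xi/= (idxE n)//.
      by case.
  + by apply: measurableI => //; exact: mX.
- apply: measurable_funTS; apply: measurable_fun_xsection_finite_kernel.
  by rewrite inE.
- exact: trivIset_seqDU.
Qed.
End sigma_finite_disintegration.

(** * The action space *)

Section borel_sets.

Lemma open_measurable_borel (T : ptopologicalType) (U : set T) :
  open U -> measurable (U : set (borel T)).
Proof. exact: sub_sigma_algebra. Qed.

Lemma measurable_fun_borel d (Y : measurableType d) (T : ptopologicalType)
    (f : Y -> borel T) :
  (forall U : set T, open U -> measurable (f @^-1` U)) -> measurable_fun setT f.
Proof.
move=> mf; apply: (measurability _ (erefl : @measurable _ (borel T) = <<s @open T >>)).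
by move=> _ [U oU <-]; rewrite setTI; exact: mf.
Qed.

End borel_sets.

Section compact_nested.

Lemma compact_nested (T : topologicalType) (C : nat -> set T) :
  compact [set: T] -> (forall n, closed (C n)) -> (forall n, C n.+1 `<=` C n) ->
  (forall n, C n !=set0) -> \bigcap_n C n !=set0.
Proof.
move=> /compact_near_coveringP cT clC decC C0; apply: contrapT => noC.
have monoC m n : (m <= n)%N -> C n `<=` C m.
  elim: n => [|n ih]; first by rewrite leqn0 => /eqP ->.
  rewrite leq_eqVlt => /orP[/eqP -> //|/ih mn x Cx].
  by apply: mn; exact: decC.
have key (x : T) : [set: T] x -> \forall x' \near x & n \near \oo, ~ C n x'.
  move=> _; have [n nCx] : exists n, ~ C n x.
    apply: contrapT => h; apply: noC; exists x => n _.
    by apply: contrapT => nC; apply: h; exists n.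
  exists (~` C n, [set k | (n <= k)%N]) => /=.
    split; last by exists n.
    by apply: open_nbhs_nbhs; split => //; exact: closed_openC.
  by move=> [y k] /= [nCy nk] /(monoC _ _ nk).
have [N _ /(_ N (leqnn N)) CN] := cT nat \oo (fun n x => ~ C n x) _ key.
by have [x Cx] := C0 N; exact: CN x I Cx.
Qed.

End compact_nested.

Section extended_time.
Context {R : realType}.
Local Notation nonneg := (set_type [set t : R | (0 <= t)%R]).

Definition time_to_real (t : extended_time R) : R :=
  if t is Some u then \val u else (-1)%R.

Definition real_to_time (x : R) : extended_time R :=
  match pselect ([set t : R | (0 <= t)%R] x) with
  | left x0 => Some (exist _ x (mem_set x0) : nonneg)
  | right _ => None
  end.

Lemma time_to_realK : cancel time_to_real real_to_time.
Proof.
move=> [[t t0]|]; rewrite /time_to_real /real_to_time; case: pselect => //=.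
- by move=> t0'; congr Some; exact: val_inj.
- by move=> /(_ (set_mem t0)).
- by move=> ?; exfalso; lra.
Qed.

Lemma open_time_gt (x : R) : open [set t : extended_time R | (x < time_to_real t)%R /\ t <> None].
Proof.
rewrite (_ : [set _ | _] = Some @` [set t : nonneg | (x < \val t)%R]).
  apply: one_point_compactification_open_some.
  by exists `]x, +oo[%classic => //; apply/funext => t /=; rewrite in_itv/= andbT.
apply/seteqP; split => [[t|] /= [xt]//|_ [t xt <-]//].
by exists t.
Qed.

Lemma measurable_time_to_real :
  measurable_fun setT (time_to_real : borel (extended_time R) -> R).
Proof.
apply: (measurability _ (RGenOInfty.measurableE R)) => _ [_ [x ->] <-].
rewrite setTI.
have mgt : measurable ([set t | (x < time_to_real t)%R /\ t <> None]
    : set (borel (extended_time R))).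
  by apply: open_measurable_borel; exact: open_time_gt.
have mNone : measurable ([set None] : set (borel (extended_time R))).
  rewrite (_ : [set None] = ~` (Some @` [set: nonneg])).
    apply: measurableC; apply: open_measurable_borel.
    by apply: one_point_compactification_open_some; exact: openT.
  by apply/seteqP; split => [_ -> [t]//|[t h|//]]; exfalso; apply: h; exists t.
have [x1|x1] := ltP x (-1)%R.
  rewrite (_ : _ @^-1` _ = [set t | (x < time_to_real t)%R /\ t <> None] `|` [set None]).
    exact: measurableU.
  apply/seteqP; split => [[t|]|[t|]] /=; rewrite in_itv/= andbT.
  - by move=> xt; left.
  - by right.
  - by move=> [[]|].
  - by [].
rewrite (_ : _ @^-1` _ = [set t | (x < time_to_real t)%R /\ t <> None]) //.
apply/seteqP; split => [[t|]|[t|]] /=; rewrite in_itv/= andbT //.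
- by rewrite ltNge x1.
- by case.
- by case.
Qed.

Lemma measurable_real_to_time :
  measurable_fun setT (real_to_time : R -> borel (extended_time R)).
Proof.
apply: measurable_fun_borel => U oU.
have [W oW WU] : exists2 W : set R, open W & set_val @^-1` W = Some @^-1` U :> set nonneg.
  have : open (Some @^-1` U : set nonneg).
    by move/continuousP : (@one_point_compactification_some_continuous nonneg);
      exact.
  by case=> W oW WU; exists W.
have mW : measurable (W `&` `[0%R, +oo[%classic).
  by apply: measurableI => //; exact: open_measurable.
have pos x : (0 <= x)%R -> (real_to_time @^-1` U) x <-> W x.
  move=> x0; rewrite /real_to_time /=; case: pselect => //= x0'.
  set y := exist _ _ _ : nonneg.
  by have := congr1 (fun A => A y) WU; rewrite /= /set_val/= => ->.
have neg x : (x < 0)%R -> real_to_time x = None.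
  by move=> x0; rewrite /real_to_time; case: pselect => // x0'; exfalso; move: x0';
    rewrite /= leNgt x0.
have [UN|UN] := pselect (U None).
  rewrite (_ : _ @^-1` _ = `]-oo, 0%R[%classic `|` (W `&` `[0%R, +oo[%classic)).
    exact: measurableU.
  apply/seteqP; split => x /=; rewrite !in_itv/= andbT; have [x0|x0] := leP 0%R x.
  - by move/(pos x x0) => Wx; right.
  - by left.
  - by case=> // -[Wx _]; apply/(pos x x0).
  - by rewrite neg.
rewrite (_ : _ @^-1` _ = W `&` `[0%R, +oo[%classic)//.
apply/seteqP; split => x /=; rewrite !in_itv/= andbT; have [x0|x0] := leP 0%R x.
- by move/(pos x x0) => Wx; split.
- by rewrite neg.
- by case=> Wx _; apply/(pos x x0).
- by case.
Qed.

Lemma real_retract_time : @real_retract R _ (borel (extended_time R)).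
Proof.
exists time_to_real, real_to_time; split.
- exact: measurable_time_to_real.
- exact: measurable_real_to_time.
- exact: time_to_realK.
Qed.

End extended_time.

(** * Countable bases and coding of compact spaces *)

Section countable_base.
Context {R : realType}.

(** What is retained from separable metrizability. The closure clause lets [base_codeP] replace open
    conditions by closed ones, to which compactness applies. *)
Definition regular_base (T : topologicalType) (V : nat -> set T) : Prop :=
  (forall n, open (V n)) /\
  forall (U : set T) x, open U -> U x ->
    exists n, V n x /\ closure (V n) `<=` U.

Lemma metric_regular_base (T : topologicalType) (M : metricType R) (D : set M)
    (h : T -> M) :
  countable D -> dense D -> continuous h ->
  (forall U : set T, open U -> exists W : set M, open W /\ U = h @^-1` W) ->
  exists V : nat -> set T, regular_base V.
Proof.
move=> /countable_injP[e einj] dD ch hinit.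
pose r (n : nat) : R := (n.+1%:R^-1)%R.
have r0 n : (0 < r n)%R by rewrite invr_gt0.
(* Since [e] is injective on D, the union has at most one member. The centres lie in M and need not
   belong to the image of [h]. *)
pose V (k : nat) : set T := if @unpickle (nat * nat)%type k is Some p then
  \bigcup_(c in [set c | D c /\ e c = p.1]) (h @^-1` (ball c (r p.2))^°) else set0.
exists V; split => [n|U x oU Ux].
  rewrite /V; case: unpickle => [[i n']|]; last exact: open0.
  by apply: bigcup_open => c _; move/continuousP : ch; apply; exact: open_interior.
have [W [oW UW]] := hinit U oU; rewrite UW in Ux *.
have : nbhs (h x) W by apply: open_nbhs_nbhs.
move=> /nbhs_ballP[eps /= eps0 epsW].
pose n := Num.truncn (4 / eps)%R.
(* A point y in the closure of the chosen member has h y within r/2 + r + r of h x, which 4 r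
   covers. *)
have rn : (4 * r n < eps)%R.
  by rewrite /r ltr_pdivrMr// mulrC -ltr_pdivrMr// truncnS_gt.
have [c [Dc hxc]] : D `&` (ball (h x) (r n / 2))^° !=set0.
  rewrite setIC; apply: dD; last exact: open_interior.
  by exists (h x); apply: nbhsx_ballx; rewrite divr_gt0.
have {}hxc : ball c (r n / 2)%R (h x) by apply: ball_sym; exact: interior_subset hxc.
exists (pickle (e c, n)); rewrite /V pickleK /=; split.
  exists c => //=; apply: (@filterS _ _ _ (ball (h x) (r n / 2)%R)).
    move=> y xy; rewrite (splitr (r n)); exact: ball_triangle hxc xy.
  by apply: nbhsx_ballx; rewrite divr_gt0.
move=> y cly; apply: epsW.
have : nbhs y (h @^-1` (ball (h y) (r n))).
  by apply: ch; exact: nbhsx_ballx.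
move=> /cly[z [[c' [/= Dc' ec'] hz] hyz]].
have {}hz := interior_subset hz.
have cc' : c' = c by apply: einj => //; rewrite inE.
rewrite {}cc' in hz.
apply: (@le_ball _ _ _ (r n / 2 + r n + r n)%R); first by have := r0 n; lra.
apply: (@ball_triangle _ _ (h z)); last exact: ball_sym.
apply: (@ball_triangle _ _ c) => //; exact: ball_sym.
Qed.

Lemma borel_space_regular_base (T : ptopologicalType) :
  borel_space R T -> hausdorff_space T /\ exists V : nat -> set T, regular_base V.
Proof.
move=> [P [S [[[D cD dD] [M [[k [k' [ck ck' kk' k'k]]] _]]] _ [i [i' [ci ci' ii' i'i]]]]]].
pose h (x : T) : M := k (set_val (i x)).
have ch : continuous h.
  move=> x; apply: continuous_comp; last exact: ck.
  apply: continuous_comp; first exact: ci.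
  exact: initial_continuous.
have hinj : injective h.
  move=> x y /(can_inj kk') xy; apply: (can_inj ii'); exact: val_inj.
split.
  move=> x y xy; apply: hinj; apply: (metric_hausdorff (T := M)).
  move=> A B nA nB; have [z [Az Bz]] := xy _ _ (ch x _ nA) (ch y _ nB).
  by exists (h z).
apply: (@metric_regular_base T M (k @` D) h) => //.
- exact: (card_le_trans (card_image_le _ _) cD).
- move=> W [w Ww] oW.
  have [|p [Wp Dp]] := dD (k @^-1` W) _ (ltac:(by move/continuousP : ck; apply)).
    by exists (k' w); rewrite /preimage/= k'k.
  by exists (k p); split => //; exists p.
- move=> U oU.
  have : open (i' @^-1` U) by move/continuousP : ci'; apply.
  case=> W oW WU; exists (k' @^-1` W); split; first by move/continuousP : ck'; apply.
  apply/seteqP; split => x /=.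
    move=> Ux; have : (i' @^-1` U) (i x) by rewrite /preimage/= ii'.
    by rewrite -WU /preimage/= /h kk'.
  rewrite /h kk' => Wx; have : (set_val @^-1` W) (i x) by [].
  by rewrite WU /preimage/= ii'.
Qed.

End countable_base.

Section retract_compact.
Context {R : realType} (T : ptopologicalType) (V : nat -> set T).
Hypothesis cT : compact [set: T].
Hypothesis hT : hausdorff_space T.
Hypothesis baseV : regular_base V.

Let oV n : open (V n). Proof. by case: baseV. Qed.

Definition base_code (x : T) (n : nat) : bool := `[< V n x >].

Let code_inj : injective base_code.
Proof.
move=> x y xy; apply: contrapT => /eqP nxy.
have := hT; rewrite open_hausdorff => /(_ x y nxy)[[A B] /= [xA yB] [oA oB /eqP AB0]].
have [n [Vnx clV]] := baseV.2 A x oA (set_mem xA).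
have Vny : V n y by apply/asboolP; rewrite -[asbool _]/(base_code y n) -xy;
  apply/asboolP.
have : (A `&` B) y by split; [exact: clV (subset_closure Vny)|exact: set_mem].
by rewrite AB0.
Qed.

(** Points compatible with the first N bits. A bit equal to 1 asks only for the closure, which keeps
    the traces closed; the second condition of [base_codeP] restores the open set. *)
Definition code_trace (c : nat -> bool) (N : nat) : set T :=
  [set x | forall n, (n < N)%N -> if c n then closure (V n) x else ~ V n x].

(* A sequence satisfying these countably many conditions codes the point that
   compactness provides in the intersection of its traces. *)
Lemma base_codeP (c : nat -> bool) :
  (exists x, forall n, c n = base_code x n) <->
  (forall N, code_trace c N !=set0) /\
  (forall n, c n -> exists m, c m /\ closure (V m) `<=` V n).
Proof.
split=> [[x cx]|[c1 c2]].
  split=> [N|n].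
    exists x => n _; rewrite cx /base_code; case: asboolP => // Vnx.
    exact: subset_closure.
  rewrite cx => /asboolP /(baseV.2 _ _ (oV n))[m [Vmx clV]].
  by exists m; split => //; rewrite cx; apply/asboolP.
have clC n : closed (if c n then closure (V n) else ~` V n).
  case: ifP => _; first exact: closed_closure.
  exact: open_closedC.
have [x Kx] : \bigcap_N code_trace c N !=set0.
  apply: compact_nested => // N; last by move=> x h n nN; apply: h; exact: ltnW.
  rewrite (_ : code_trace c N = \bigcap_(n in [set n | (n < N)%N])
      (if c n then closure (V n) else ~` V n)).
    by apply: closed_bigI => n _.
  by apply/seteqP; split => x h n nN; have := h n nN; case: (c n).
exists x => n; rewrite /base_code; apply/idP/asboolP => [cn|Vnx].
  have [m [cm clV]] := c2 n cn; apply: clV.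
  by have := Kx m.+1 I m (ltnSn m); rewrite cm.
by apply: contrapT => /negP/negbTE cn; have := Kx n.+1 I n (ltnSn n); rewrite cn.
Qed.

Definition base_decode (x : R) : T :=
  xget point [set y | forall n, ternary_digit x n = base_code y n].

Lemma base_decodeK (y : T) :
  base_decode (fine (ternary (base_code y))) = y.
Proof.
apply: xget_unique => [n|z h]; first by rewrite ternaryK.
by apply: code_inj; apply/funext => n; rewrite -h ternaryK.
Qed.

Let mdigit n : measurable [set x : R | ternary_digit x n].
Proof.
have := @measurable_ternary_digit R n measurableT [set true] (ltac:(by [])).
by rewrite setTI.
Qed.

(** By [base_codeP] being a code is a countable family of conditions on digits. That the N-th trace
    is nonempty depends on the first N digits only, so it is a finite union of cylinders [W w]. *)
Lemma measurable_codes :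
  measurable [set x : R | exists y, forall n, ternary_digit x n = base_code y n].
Proof.
rewrite (_ : [set _ | _] = \bigcap_N [set x : R | code_trace (ternary_digit x) N !=set0] `&`
    \bigcap_n ((~` [set x : R | ternary_digit x n]) `|`
       \bigcup_(m in [set m | closure (V m) `<=` V n]) [set x : R | ternary_digit x m])).
  apply: measurableI; apply: bigcapT_measurable => N.
    pose W (w : N.-tuple bool) : set R := if pselect (exists x : R, (forall n : 'I_N, ternary_digit x n = tnth w n) /\ code_trace (ternary_digit x) N !=set0)
      then \bigcap_(n : 'I_N) [set x | ternary_digit x n = tnth w n] else set0.
    rewrite (_ : [set _ | _] = \bigcup_w W w).
      apply: countable_bigcupT_measurable => // w; rewrite /W.
      case: pselect => h; last exact: measurable0.
      apply: fin_bigcap_measurable => // n _.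
      case: (tnth w n); first exact: mdigit.
      rewrite (_ : [set _ | _] = ~` [set x : R | ternary_digit x n]).
        exact: measurableC.
      apply/seteqP; split => x /=; [by move=> ->|by move/negP/negbTE].
    apply/seteqP; split => x /=.
      move=> xN; exists [tuple ternary_digit x n | n < N] => //.
      rewrite /W; case: pselect => [h n _ /=|]; first by rewrite tnth_mktuple.
      by case; exists x; split => // n; rewrite tnth_mktuple.
    move=> [w _]; rewrite /W; case: pselect => // -[x' [x'w [y Ky]]] xw.
    exists y => n nN; have := Ky n nN.
    by rewrite (x'w (Ordinal nN)) -(xw (Ordinal nN) I).
  apply: measurableU; first exact: measurableC.
  by apply: bigcup_measurable => m _.
apply/seteqP; split => x /=.
  move/base_codeP => [c1 c2]; split => [N _|n _]; first exact: c1.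
  have [/c2[m [cm clV]]|] := boolP (ternary_digit x n); last by left; exact/negP.
  by right; exists m.
move=> [c1 c2]; apply/base_codeP; split => [N|n cn]; first exact: c1.
by case: (c2 n I) => [//|[m clV cm]]; exists m.
Qed.

(** Over the set [E] of codes, membership of the decoded point in V n is just the n-th digit; off
    [E] the decoded point is the constant [point]. *)
Lemma measurable_base_decode :
  measurable_fun setT (base_decode : R -> borel T).
Proof.
apply: measurable_fun_borel => U oU.
rewrite (_ : _ @^-1` U = \bigcup_(n in [set n | V n `<=` U]) (base_decode @^-1` V n)).
  apply: bigcup_measurable => n _.
  set E := [set x : R | exists y, forall n, ternary_digit x n = base_code y n].
  have mE : measurable E := measurable_codes.
  have E1 x : E x -> (base_decode x \in V n) = ternary_digit x n.
    move=> [y xy]; rewrite (xy n) (_ : base_decode x = y).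
      by apply/idP/asboolP => [/set_mem|/mem_set].
    apply: xget_unique => // z xz; apply: code_inj.
    by apply/funext => k; rewrite -xy -xz.
  have E0 x : ~ E x -> base_decode x = point.
    by move=> nE; rewrite /base_decode; case: xgetP => // y _ xy; case: nE; exists y.
  have [Vp|Vp] := pselect (V n point).
    rewrite (_ : _ @^-1` _ = (E `&` [set x : R | ternary_digit x n]) `|` ~` E).
      by apply: measurableU; [exact: measurableI|exact: measurableC].
    apply/seteqP; split => x /=.
      by have [Ex|] := pselect (E x); [move/mem_set; rewrite E1//; left|right].
    by move=> [[Ex]|/E0 ->//]; rewrite -E1// => /set_mem.
  rewrite (_ : _ @^-1` _ = E `&` [set x : R | ternary_digit x n]);
    first exact: measurableI.
  apply/seteqP; split => x /=.
    by have [Ex|/E0 ->//] := pselect (E x); move/mem_set; rewrite E1.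
  by move=> [Ex]; rewrite -E1// => /set_mem.
apply/seteqP; split => x /=; last by move=> [n /= VU /VU].
by move=> /(baseV.2 _ _ oU)[n [Vx clV]]; exists n => //= y Vy; apply: clV;
  exact: subset_closure.
Qed.

Lemma real_retract_compact : @real_retract R _ (borel T).
Proof.
exists (fun y => fine (ternary (base_code y))), base_decode; split.
- apply: measurable_ternary => n; apply: (measurable_fun_bool true).
  rewrite setTI; apply: open_measurable_borel.
  rewrite (_ : _ @^-1` _ = V n)//; apply/seteqP; split => y /=.
    by move/eqP; rewrite eqb_id => /asboolP.
  by move=> Vy; apply/asboolP.
- exact: measurable_base_decode.
- exact: base_decodeK.
Qed.

End retract_compact.

Lemma real_retract_action (R : realType) (A : ptopologicalType) :
  borel_space R A -> compact [set: A] -> @real_retract R _ (action R A).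
Proof.
move=> /borel_space_regular_base[hA [V baseV]] cA.
apply: real_retract_prod; first exact: real_retract_time.
exact: (real_retract_compact cA hA baseV).
Qed.

(** * The decision process *)

Section mdp_measurability.
Context {R : realType} {X A : ptopologicalType} {J : nat}.
Variable M : impulse_model R X A J.
Local Notation state := (state X).
Local Notation action := (action R A).

(** This and [nonneg_time] are total substitutes for partial data: the cemetery becomes [point] and
    the infinite time 0. Formulas are computed with them first and corrected by an [isSome] test. *)
Definition state_point (x : state) : borel X := odflt point x.

Definition nonneg_time (b : action) : R := Num.max 0%R (time_to_real b.1).

Lemma measurable_Some : measurable_fun setT (Some : borel X -> state).
Proof. by apply: measurable_fun_borel => U oU; exact: open_measurable_borel. Qed.

Lemma open_Some (U : set X) : open U -> open (Some @` U : set (add_isolated X)).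
Proof.
move=> oU; suff : open (Some @^-1` (Some @` U) : set X) by [].
rewrite (_ : _ @^-1` _ = U)//; apply/seteqP; split => x; last by exists x.
by move=> [y Uy [<-]].
Qed.

Lemma measurable_None : measurable ([set None] : set state).
Proof.
apply: open_measurable_borel; suff : open (Some @^-1` [set None] : set X) by [].
by rewrite (_ : _ @^-1` _ = set0); [exact: open0|apply/seteqP; split].
Qed.

Lemma measurable_state_point : measurable_fun setT state_point.
Proof.
apply: measurable_fun_borel => U oU.
have [Up|Up] := pselect (U point).
  rewrite (_ : _ @^-1` _ = Some @` U `|` [set None]).
    apply: measurableU; last exact: measurable_None.
    by apply: open_measurable_borel; exact: open_Some.
  apply/seteqP; split => [[x Ux|_]|x [[y Uy <-//]| -> //]]; last by right.
  by left; exists x.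
rewrite (_ : _ @^-1` _ = Some @` U).
  by apply: open_measurable_borel; exact: open_Some.
by apply/seteqP; split => [[x Ux|//]|x [y Uy <-//]]; exists x.
Qed.

Lemma measurable_isSome_state : measurable_fun setT (isSome : state -> bool).
Proof.
apply: (measurable_fun_bool false); rewrite setTI.
rewrite (_ : _ @^-1` _ = [set None]); first exact: measurable_None.
by apply/seteqP; split => [[]|_ ->].
Qed.

Lemma measurable_isSome_time :
  measurable_fun setT (isSome : borel (extended_time R) -> bool).
Proof.
have -> : (isSome : extended_time R -> bool) = (fun t => 0%R <= time_to_real t)%R.
  apply/funext => -[t|] /=; first by apply/esym/idP; exact: (set_mem (valP t)).
  by apply/esym/negbTE; rewrite -ltNge ltrN10.
by apply: measurable_fun_ler => //; exact: measurable_time_to_real.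
Qed.

Lemma measurable_nonneg_time : measurable_fun setT nonneg_time.
Proof.
apply: measurable_maxr => //.
exact: (measurableT_comp measurable_time_to_real measurable_fst).
Qed.

Lemma nonneg_timeE t a : nonneg_time (Some t, a) = \val t.
Proof. by apply/max_idPr; exact: (set_mem (valP t)). Qed.

(** Times are clipped at 0 because the model makes the flow measurable on nonnegative times only. *)
Lemma measurable_flow_max : measurable_fun setT
  (fun p : borel X * R => flow M p.1 (Num.max 0%R p.2) : borel X).
Proof.
apply: (@measurable_comp _ _ _ _ _ _ [set p : borel X * R | (0 <= p.2)%R]
  (fun p => flow M p.1 p.2 : borel X) setT
  (fun p : borel X * R => (p.1, Num.max 0%R p.2))).
- have := @measurable_fun_ler _ _ R setT _ _ (@measurable_cst _ _ (borel X * R)%type R setT 0%R)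
    measurable_snd measurableT [set true] (ltac:(by [])).
  by rewrite setTI.
- by move=> _ [p _ <-]; rewrite /= le_max lexx.
- exact: (measurable_flow M).
- apply: measurable_fun_pair; first exact: measurable_fst.
  by apply: measurable_maxr.
Qed.

Definition landing (p : state * action) : borel X :=
  flow M (state_point p.1) (nonneg_time p.2).

Lemma measurable_landing : measurable_fun setT landing.
Proof.
rewrite (_ : landing = (fun q : borel X * R => flow M q.1 (Num.max 0%R q.2) : borel X) \o
   (fun p : state * action => (state_point p.1, nonneg_time p.2))); last first.
  apply/funext => p; rewrite /landing /=; congr flow.
  by apply/esym/max_idPr; rewrite /nonneg_time le_max lexx.
apply: (measurableT_comp measurable_flow_max); apply: measurable_fun_pair.
  exact: (measurableT_comp measurable_state_point measurable_fst).
exact: (measurableT_comp measurable_nonneg_time measurable_snd).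
Qed.

Lemma measurable_next_state :
  measurable_fun setT (fun p : state * action => next_state M p.1 p.2 : state).
Proof.
rewrite (_ : (fun p => _) = fun p : state * action =>
   if isSome p.1 && isSome p.2.1 then Some (jump M (landing p) p.2.2) : state else None).
  apply: measurable_fun_ifT.
  - apply: measurable_and; first exact: (measurableT_comp measurable_isSome_state).
    apply: (measurableT_comp measurable_isSome_time).
    exact: (measurableT_comp measurable_fst measurable_snd).
  - apply: (measurableT_comp measurable_Some).
    apply: (measurableT_comp (measurable_jump M) (g := fun p : state * action => (landing p, p.2.2))).
    apply: measurable_fun_pair; first exact: measurable_landing.
    exact: (measurableT_comp measurable_snd measurable_snd).
  - exact: measurable_cst.
apply/funext => -[[x|] [[t|] a]] //=.
by rewrite /landing /= nonneg_timeE.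
Qed.

Lemma transitionE x b U :
  transition M x b U = (\1_U (next_state M x b))%:E.
Proof. by []. Qed.

Lemma stage_cost_ge0 j x b : 0 <= stage_cost M j x b.
Proof.
have g0 y (D : set R) : 0 <= \int[lebesgue_measure]_(u in D) (gcost M j (flow M y u))%:E.
  by apply: integral_ge0 => u _; rewrite lee_fin gcost_ge0.
case: x b => [y|] [[t|] a] //=.
by rewrite adde_ge0// lee_fin icost_ge0.
Qed.

(** The variable domain of integration is moved into a jointly measurable integrand on the whole
    line, [G] for finite times and [G'] for infinity, so that Tonelli applies. *)
Lemma measurable_stage_cost j :
  measurable_fun setT (fun p : state * action => stage_cost M j p.1 p.2).
Proof.
pose G (q : (borel X * R) * measurableTypeR R) : \bar R :=
  if (q.2 <= q.1.2)%R && (0 <= q.2)%R then (gcost M j (flow M q.1.1 (Num.max 0%R q.2)))%:E else 0.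
pose G' (q : borel X * measurableTypeR R) : \bar R :=
  if (0 <= q.2)%R then (gcost M j (flow M q.1 (Num.max 0%R q.2)))%:E else 0.
have mid : measurable_fun setT (id : measurableTypeR R -> R) by move=> _ Y mY;
  rewrite setTI.
have mg d (T : measurableType d) (y : T -> borel X) (u : T -> R) :
    measurable_fun setT y -> measurable_fun setT u ->
    measurable_fun setT (fun p => (gcost M j (flow M (y p) (Num.max 0%R (u p))))%:E).
  move=> my mu; apply/measurable_EFinP;
    apply: (measurableT_comp (measurable_gcost M j)).
  by apply: (measurableT_comp measurable_flow_max (g := fun p => (y p, u p)));
    exact: measurable_fun_pair.
have mG : measurable_fun setT G.
  have m2 : measurable_fun setT (fun q : (borel X * R) * measurableTypeR R => q.2 : R).
    exact: (measurableT_comp mid measurable_snd).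
  apply: measurable_fun_ifT => //.
    apply: measurable_and; apply: measurable_fun_ler => //.
    exact: (measurableT_comp measurable_snd measurable_fst).
  by apply: mg => //; exact: (measurableT_comp measurable_fst measurable_fst).
have mG' : measurable_fun setT G'.
  have m2 : measurable_fun setT (fun q : borel X * measurableTypeR R => q.2 : R).
    exact: (measurableT_comp mid measurable_snd).
  apply: measurable_fun_ifT => //; first exact: measurable_fun_ler.
  by apply: mg => //; exact: measurable_fst.
have G0 q : 0 <= G q by rewrite /G; case: ifP => // _; rewrite lee_fin gcost_ge0.
have G'0 q : 0 <= G' q by rewrite /G'; case: ifP => // _; rewrite lee_fin gcost_ge0.
have mI := @measurable_fun_fubini_tonelli_F _ _ _ _ R (@lebesgue_measure R) G mG G0.
have mI' := @measurable_fun_fubini_tonelli_F _ _ _ _ R (@lebesgue_measure R) G' mG' G'0.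
rewrite (_ : (fun p => _) = fun p : state * action =>
   if isSome p.1 then if isSome p.2.1 then
     fubini_F lebesgue_measure G (state_point p.1, nonneg_time p.2) + (icost M j (landing p) p.2.2)%:E
   else fubini_F lebesgue_measure G' (state_point p.1) else 0).
  apply: measurable_fun_ifT => //;
    first exact: (measurableT_comp measurable_isSome_state).
  apply: measurable_fun_ifT => //.
  - apply: (measurableT_comp measurable_isSome_time).
    exact: (measurableT_comp measurable_fst measurable_snd).
  - apply: emeasurable_funD.
      apply: (measurableT_comp mI (g := fun p : state * action => (state_point p.1, nonneg_time p.2))).
      apply: measurable_fun_pair.
        exact: (measurableT_comp measurable_state_point measurable_fst).
      exact: (measurableT_comp measurable_nonneg_time measurable_snd).
    apply/measurable_EFinP.
    apply: (measurableT_comp (measurable_icost M j) (g := fun p : state * action => (landing p, p.2.2))).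
    apply: measurable_fun_pair; first exact: measurable_landing.
    exact: (measurableT_comp measurable_snd measurable_snd).
  - apply: (measurableT_comp mI').
    exact: (measurableT_comp measurable_state_point measurable_fst).
apply/funext => -[[x|] [[t|] a]] //=.
- rewrite /landing /= nonneg_timeE; congr (_ + _).
  rewrite integral_mkcond /fubini_F /=; apply: eq_integral => u _.
  rewrite patchE /G /= mem_setE in_itv/= andbC; case: ifPn => // /andP[ut u0].
  by rewrite (max_idPr u0).
- rewrite integral_mkcond /fubini_F /=; apply: eq_integral => u _.
  rewrite patchE /G' /= mem_setE in_itv/= andbT; case: ifPn => // u0.
  by rewrite (max_idPr u0).
Qed.

End mdp_measurability.

Section image_probability.
Context {R : realType} d1 d2 (T1 : measurableType d1) (T2 : measurableType d2).
Variables (P : probability T1 R) (f : T1 -> T2) (mf : measurable_fun setT f).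

Definition image_probability : set T2 -> \bar R := image_measure P mf.

HB.instance Definition _ := Measure.on image_probability.

Let image_probabilityT : image_probability setT = 1.
Proof. exact: (probability_setT P). Qed.

HB.instance Definition _ := Measure_isProbability.Build _ _ R image_probability
  image_probabilityT.

End image_probability.

Section paths.
Context {R : realType} {X A : ptopologicalType}.
Local Notation state := (state X).
Local Notation action := (action R A).
Local Notation path_space := (@path_space R X A).

Lemma measurable_coord n : measurable_fun setT (fun w : path_space => w n).
Proof.
move=> _ U mU; rewrite setTI; apply: sub_sigma_algebra; exists n, U.
by split.
Qed.

Lemma measurable_path_prefix n :
  measurable_fun setT (path_prefix n : path_space -> n.-tuple (state * action)).
Proof.
apply/measurable_fun_tnthP => i.
rewrite (_ : _ \o _ = fun w : path_space => w i); first exact: measurable_coord.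
by apply/funext => w; rewrite /= tnth_mktuple.
Qed.

Lemma measurable_path_history n :
  measurable_fun setT (path_history n : path_space -> @history R X A n).
Proof.
apply: measurable_fun_pair; first exact: measurable_path_prefix.
exact: (measurableT_comp measurable_fst (measurable_coord n)).
Qed.

Lemma measurable_fun_path d (Y : measurableType d) (f : Y -> path_space) :
  (forall n, measurable_fun setT (fun y => f y n)) -> measurable_fun setT f.
Proof.
move=> mf; apply: (measurability _ (erefl : @measurable _ path_space = <<s @cylinders R X A >>)).
move=> _ [_ [n [U [mU ->]]] <-]; rewrite setTI.
exact: (measurable_preim (mf n) mU).
Qed.

End paths.

(** * Simulation of the process from one uniform variable *)

Section law_existence.
Context {R : realType} {X A : ptopologicalType} {J : nat}.
Variable M : impulse_model R X A J.
Local Notation state := (state X).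
Local Notation action := (action R A).
Local Notation history := (@history R X A).
Local Notation path_space := (@path_space R X A).
Variables (x : state) (pi : @strategy R X A).
Variable xi : forall n, history n * R -> action.
Hypothesis mxi : forall n, measurable_fun setT (@xi n).
Hypothesis xiE : forall n h U, measurable U ->
  pi n h U = unif [set u | U (xi (h, u))].
Variable split : R -> R * R.
Hypothesis msplit : measurable_fun setT split.
Hypothesis splitE : forall G, measurable G ->
  unif (split @^-1` G) = (unif \x unif) G.

Definition history_step n (p : history n * R) : history n.+1 :=
  ([tuple of rcons p.1.1 (p.1.2, xi p)], next_state M p.1.2 (xi p)).

(* The second component is a uniform variable independent of the history: the
   first half of its splitting selects the next action, the second half is kept
   as the randomness of the following steps. *)
Fixpoint simulated n (u : R) : history n * R :=
  if n is k.+1 then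
    let p := simulated k u in
    (history_step (p.1, (split p.2).1), (split p.2).2)
  else (([tuple], x), u).

Definition simulated_path (u : R) : path_space := fun n =>
  let p := simulated n u in (p.1.2, xi (p.1, (split p.2).1)).

Lemma measurable_history_step n : measurable_fun setT (@history_step n).
Proof.
apply: measurable_fun_pair; last first.
  apply: (measurableT_comp (measurable_next_state M)
    (g := fun p : history n * R => (p.1.2, xi p))).
  apply: measurable_fun_pair; last exact: mxi.
  exact: (measurableT_comp measurable_snd measurable_fst).
apply/measurable_fun_tnthP => i.
have [iN|iN] := ltnP i n.
  rewrite (_ : _ \o _ = fun p : history n * R => tnth p.1.1 (Ordinal iN)).
    apply: (measurableT_comp (measurable_tnth (Ordinal iN))).
    exact: (measurableT_comp measurable_fst measurable_fst).
  apply/funext => p /=; rewrite !(tnth_nth (p.1.2, xi p)) /= nth_rcons size_tuple iN.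
  by [].
rewrite (_ : _ \o _ = fun p : history n * R => (p.1.2, xi p)).
  apply: measurable_fun_pair; last exact: mxi.
  exact: (measurableT_comp measurable_snd measurable_fst).
apply/funext => p /=; rewrite (tnth_nth (p.1.2, xi p)) /= nth_rcons size_tuple.
have -> : i = n :> nat by apply/eqP; rewrite eqn_leq iN -ltnS ltn_ord.
by rewrite ltnn eqxx.
Qed.

Lemma measurable_split1 n : measurable_fun setT
  (fun p : history n * R => (p.1, (split p.2).1)).
Proof.
apply: measurable_fun_pair; first exact: measurable_fst.
apply: (measurableT_comp measurable_fst).
exact: (measurableT_comp msplit measurable_snd).
Qed.

Lemma measurable_simulated n : measurable_fun setT (simulated n).
Proof.
elim: n => [|n ih] /=; first by apply: measurable_fun_pair => //;
  exact: measurable_cst.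
apply: measurable_fun_pair.
  exact: (measurableT_comp (@measurable_history_step n)
    (measurableT_comp (@measurable_split1 n) ih)).
apply: (measurableT_comp measurable_snd); apply: (measurableT_comp msplit).
exact: (measurableT_comp measurable_snd ih).
Qed.

Lemma measurable_simulated_path : measurable_fun setT simulated_path.
Proof.
apply: measurable_fun_path => n; apply: measurable_fun_pair.
  apply: (measurableT_comp measurable_snd).
  exact: (measurableT_comp measurable_fst (@measurable_simulated n)).
apply: (measurableT_comp (@mxi n)).
exact: (measurableT_comp (@measurable_split1 n) (@measurable_simulated n)).
Qed.

Lemma simulated_history n u : path_history n (simulated_path u) = (simulated n u).1.
Proof.
suff E : path_prefix n (simulated_path u) = (simulated n u).1.1.
  by rewrite /path_history E /simulated_path /=; case: (simulated n u) => -[].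
elim: n => [|n ih]; first by rewrite [LHS]tuple0 [RHS]tuple0.
apply: eq_from_tnth => i; rewrite tnth_mktuple /=.
have [iN|iN] := ltnP i n.
  rewrite (tnth_nth (simulated_path u 0%N)) /= nth_rcons size_tuple iN -ih.
  by rewrite -[i : nat]/(nat_of_ord (Ordinal iN)) -tnth_nth tnth_mktuple.
rewrite (tnth_nth (simulated_path u 0%N)) /= nth_rcons size_tuple.
have -> : i = n :> nat by apply/eqP; rewrite eqn_leq iN -ltnS ltn_ord.
by rewrite ltnn eqxx /simulated_path /=.
Qed.

Definition simulated_law n : {measure set (history n) -> \bar R} :=
  image_measure (@unif R) (measurableT_comp measurable_fst (@measurable_simulated n)).

Lemma unif_split1 (W : set R) : measurable W ->
  unif [set r | W (split r).1] = unif W.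
Proof.
move=> mW; have := splitE (measurableX mW (@measurableT _ R)).
rewrite product_measure1E// => e; transitivity (unif (split @^-1` (W `*` setT))).
  by congr (unif _); apply/seteqP; split => [r|r []].
by rewrite e -[RHS]mule1; congr (_ * _); exact: probability_setT.
Qed.

(** Given the history, splitting the kept variable yields two independent uniform ones; the first
    determines the new history and the second is the new kept variable. So independence passes from
    one step to the next. *)
Lemma simulated_independent n E : measurable E ->
  unif (simulated n @^-1` E) = \int[simulated_law n]_h unif (xsection E h).
Proof.
have fin k : image_measure unif (@measurable_simulated k) setT < +oo.
  by rewrite [X in X < _](_ : _ = 1) ?ltry//; exact: (probability_setT unif).
elim: n E => [|n ih] E mE; apply: (@measure_unique_rectangles R _ _ _ _
  (image_measure unif (@measurable_simulated _)) (simulated_law _ \x unif) (fin _)) => //.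
  move=> D W mD mW; apply: etrans (esym (product_measure1E _ _ mD mW)).
  suff : unif [set u | D ([tuple], x) /\ W u] = unif [set u : R | D ([tuple], x)] * unif W.
    by [].
  have [Dx|Dx] := pselect (D ([tuple], x)).
    rewrite (_ : [set u | D _ /\ W u] = W); last by apply/seteqP; split => [u []|].
    rewrite (_ : [set _ | D _] = setT); last by apply/seteqP; split.
    by rewrite probability_setT mul1e.
  rewrite (_ : [set u | D _ /\ W u] = set0); last by apply/seteqP; split => [u []|].
  rewrite (_ : [set _ | D _] = set0); last by apply/seteqP; split.
  by rewrite measure0 mul0e.
have key D W : measurable D -> measurable W ->
    unif (simulated n.+1 @^-1` (D `*` W)) =
    (\int[simulated_law n]_h unif [set v | D (history_step (h, v))]) * unif W.
  move=> mD mW.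
  have mDs : measurable (@history_step n @^-1` D).
    by apply: measurable_preim => //; exact: measurable_history_step.
  have mDh h : measurable [set v | D (history_step (h, v))].
    by have := measurable_xsection h mDs; rewrite xsectionE.
  have mWs : measurable ([set p : history n * R | W (split p.2).2]).
    apply: (@measurable_preim _ _ _ _ (fun p : history n * R => (split p.2).2)) => //.
    apply: (measurableT_comp measurable_snd).
    exact: (measurableT_comp msplit measurable_snd).
  transitivity (unif (simulated n @^-1`
      ([set p | D (history_step (p.1, (split p.2).1))] `&` [set p | W (split p.2).2]))).
    by congr (unif _).
  rewrite ih; last first.
    apply: measurableI => //.
    exact: (measurable_preim (@measurable_split1 n) mDs).
  rewrite -ge0_integralZr//.
  - apply: eq_integral => h _; have := splitE (measurableX (mDh h) mW).
    rewrite product_measure1E// => <-; congr (unif _).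
    by rewrite xsectionE.
  - have := measurable_fun_xsection (@unif R) mDs.
    by apply: eq_measurable_fun => h _ /=; rewrite xsectionE.
move=> D W mD mW; apply: etrans (esym (product_measure1E _ _ mD mW)).
rewrite -[LHS]/(unif (simulated n.+1 @^-1` (D `*` W))) key//; congr (_ * _).
(* Taking W to be the whole line in [key] identifies its first factor as the law of the new
   history. *)
transitivity (unif (simulated n.+1 @^-1` (D `*` setT))).
  by rewrite key// -[LHS]mule1; congr (_ * _); apply/esym; exact: probability_setT.
by congr (unif _); apply/seteqP; split => [u []|u].
Qed.

Lemma is_law_simulated :
  is_law M pi x (image_probability unif measurable_simulated_path).
Proof.
have mhist n : measurable_fun setT (fun u => (simulated n u).1).
  exact: (measurableT_comp measurable_fst (@measurable_simulated n)).
split.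
- move=> U mU; rewrite -[LHS]/(unif [set u : R | U x]) diracE.
  have [Ux|Ux] := pselect (U x).
    rewrite (_ : [set _ | _] = setT); last by apply/seteqP; split.
    by rewrite probability_setT mem_set.
  rewrite (_ : [set _ | _] = set0); last by apply/seteqP; split.
  by rewrite measure0 memNset.
- move=> n G U mG mU.
  have mxiU : measurable (@xi n @^-1` U) by exact: (measurable_preim (@mxi n) mU).
  have mxih (h : history n) : measurable [set v : R | U (xi (h, v))].
    exact: (measurable_preim (measurable_fun_section h (@mxi n)) mU).
  have mpi := measurable_kernel (pi n) U mU.
  apply/esym; apply: etrans (ge0_integral_image_measure _ measurable_simulated_path _ _ _) _ => //.
  + rewrite -[X in measurable X]/(path_history n @^-1` G).
    by apply: measurable_preim => //; exact: measurable_path_history.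
  + by apply: (measurableT_comp mpi); exact: measurable_path_history.
  transitivity (\int[simulated_law n]_(h in G) pi n h U).
    apply/esym; apply: etrans (ge0_integral_image_measure _ _ mG mpi _) _ => //.
    rewrite (_ : simulated_path @^-1` [set w | G (path_history n w)] = (fun u => (simulated n u).1) @^-1` G).
      by apply: eq_integral => u _; rewrite /= simulated_history.
    by apply/funext => u /=; rewrite simulated_history.
  apply/esym.
  rewrite -[LHS]/(unif [set u | G (path_history n (simulated_path u)) /\
    U (simulated_path u n).2]).
  transitivity (unif (simulated n @^-1` ([set p | G p.1] `&` [set p | U (xi (p.1, (split p.2).1))]))).
    by congr (unif _); apply/funext => u /=; rewrite simulated_history.
  rewrite simulated_independent; last first.
    apply: measurableI; first exact: (measurable_preim measurable_fst mG).
    exact: (measurable_preim (@measurable_split1 n) mxiU).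
  rewrite [RHS]integral_mkcond; apply: eq_integral => h _; rewrite patchE.
  case: ifPn => hG; rewrite xsectionE.
    rewrite xiE// -(unif_split1 (mxih h)); congr (unif _).
    by apply/seteqP; split => [u [_ /=]//|u Uu]; split => //; exact: set_mem.
  rewrite (_ : _ @^-1` _ = set0) ?measure0//.
  by apply/seteqP; split => // u [/= Gh _]; move: hG; rewrite mem_set.
- move=> n G U mG mU; have mG' : measurable [set w | G (path_prefix n.+1 w)].
    by rewrite -[X in measurable X]/(path_prefix n.+1 @^-1` G);
      apply: measurable_preim => //; exact: measurable_path_prefix.
  have mnext : measurable_fun setT (fun w : path_space => next_state M (w n).1 (w n).2 : state).
    exact: (measurableT_comp (measurable_next_state M) (measurable_coord n)).
  have mU' := measurable_preim mnext mU.
  (* The transition is a Dirac mass at a function of the current pair, so the integral is the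
     probability of the very event on the left. *)
  rewrite (eq_integral (fun w => (\1_(((fun w : path_space => next_state M (w n).1 (w n).2 : state)) @^-1` U) w)%:E)).
    rewrite integral_indic//.
    transitivity (unif (simulated_path @^-1` ([set w | G (path_prefix n.+1 w)] `&`
      (fun w : path_space => next_state M (w n).1 (w n).2 : state) @^-1` U))) => //.
    by rewrite setIC.
  by [].
Qed.

End law_existence.

Section law.
Context {R : realType} {X A : ptopologicalType} {J : nat}.
Variable M : impulse_model R X A J.

(** [law] selects some measure with the defining property, so exhibiting the simulated one is
    enough. Everything later about [law] rests on these three clauses. *)
Lemma lawP (pi : @strategy R X A) (x : state X) :
  @real_retract R _ (action R A) -> is_law M pi x (law M pi x).
Proof.
move=> rA; apply: getPex.
have ex n : exists xi : @history R X A n * R -> action R A, measurable_fun setT xi /\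
    forall h U, measurable U -> pi n h U = unif [set u | U (xi (h, u))].
  have [|U mU|xi mxi xiE] := @randomization R _ _ _ _ (pi n) rA.
  - by move=> h; exact: prob_kernel.
  - exact: measurable_kernel.
  - by exists xi.
pose xi n := sval (cid (ex n)).
have mxi n : measurable_fun setT (@xi n) by case: (svalP (cid (ex n))).
have xiE n h U : measurable U -> pi n h U = unif [set u | U (@xi n (h, u))].
  by have [_] := svalP (cid (ex n)); exact.
have [split msplit splitE] := @unif_splitting R.
by eexists; exact: (is_law_simulated M x mxi xiE msplit splitE).
Qed.

End law.

(** * Laws of single steps and occupation measures *)

Section step_law.
Context {R : realType} {X A : ptopologicalType} {J : nat}.
Variable M : impulse_model R X A J.
Local Notation state := (state X).
Local Notation action := (action R A).
Local Notation strategy := (@strategy R X A).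
Hypothesis rA : @real_retract R _ action.
Variables (pi : strategy) (x : state).

Definition step_law n : {measure set (state * action) -> \bar R} :=
  image_measure (law M pi x) (@measurable_coord R X A n).

Definition state_law n : {measure set state -> \bar R} :=
  image_measure (step_law n) measurable_fst.

Lemma step_lawT n : step_law n setT = 1.
Proof. exact: (probability_setT (law M pi x)). Qed.

Lemma expectation_series (h : state * action -> \bar R) :
  measurable_fun setT h -> (forall p, 0 <= h p) ->
  Defs.expectation M pi x (fun w => \sum_(0 <= n <oo) h (w n)) =
  \sum_(0 <= n <oo) \int[step_law n]_p h p.
Proof.
move=> mh h0; rewrite /Defs.expectation integral_nneseries//; last first.
  by move=> n; exact: (measurableT_comp mh (@measurable_coord R X A n)).
by apply: eq_eseriesr => n _; rewrite [RHS]ge0_integral_image_measure.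
Qed.

Lemma occupationE U : measurable U ->
  occupation M pi x U = \sum_(0 <= n <oo) step_law n U.
Proof.
move=> mU; rewrite /occupation (@expectation_series (fun p => (\1_U p)%:E))//.
- by apply: eq_eseriesr => n _; rewrite integral_indic// setIT.
- by apply/measurable_EFinP; exact: measurable_indic.
Qed.

Lemma integral_occupation (D : set (state * action)) (h : state * action -> \bar R) :
  measurable D -> measurable_fun setT h -> (forall p, 0 <= h p) ->
  \int[occupation M pi x]_(p in D) h p = \sum_(0 <= n <oo) \int[step_law n]_(p in D) h p.
Proof.
move=> mD mh h0; rewrite -ge0_integral_measure_series//;
  last exact: measurable_funTS.
by apply: eq_measure_integral => U mU _; rewrite [LHS]occupationE.
Qed.

Lemma total_cost_occupation j :
  total_cost M pi x j = cost_integral M setT (occupation M pi x) j.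
Proof.
rewrite /cost_integral integral_occupation//; last 2 first.
- exact: measurable_stage_cost.
- by move=> p; exact: stage_cost_ge0.
rewrite /total_cost (@expectation_series (fun p => stage_cost M j p.1 p.2))//.
- exact: measurable_stage_cost.
- by move=> p; exact: stage_cost_ge0.
Qed.

Lemma measurable_transition (G : set state) : measurable G ->
  measurable_fun setT (fun p : state * action => transition M p.1 p.2 G).
Proof.
move=> mG; rewrite (_ : (fun p => _) = EFin \o (\1_G \o
    (fun p : state * action => next_state M p.1 p.2)))//.
apply/measurable_EFinP; apply: measurableT_comp; first exact: measurable_indic.
exact: measurable_next_state.
Qed.

Lemma state_lawE n G : state_law n G = step_law n (G `*` setT).
Proof.
by congr (step_law n _); apply/seteqP; split => [[y b]|[y b] []].
Qed.

Lemma state_law0 G : measurable G -> state_law 0 G = \d_x G.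
Proof. by move=> mG; have [h _ _] := lawP M pi x rA; exact: h. Qed.

Lemma state_lawS n G : measurable G ->
  state_law n.+1 G = \int[step_law n]_p transition M p.1 p.2 G.
Proof.
move=> mG; have [_ _ h] := lawP M pi x rA.
have := h n setT G measurableT mG.
rewrite (_ : [set w | setT _ /\ _] = [set w | G (w n.+1).1]); last first.
  by apply/seteqP; split => [w []|].
rewrite (_ : [set w | setT _] = setT); last by apply/seteqP; split.
move=> e; apply: etrans e _.
by rewrite [RHS]ge0_integral_image_measure//; exact: measurable_transition.
Qed.

(** Shift of the series by one: visits at time 0 give the Dirac mass, and visits at time n + 1 come
    from the pair at time n. *)
Lemma occupation_balance G : measurable G ->
  occupation M pi x (G `*` setT) =
  \d_x G + \int[occupation M pi x]_p transition M p.1 p.2 G.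
Proof.
move=> mG; rewrite [LHS]occupationE; last exact: measurableX.
rewrite integral_occupation//; last exact: measurable_transition.
rewrite nneseries_recl//; congr (_ + _).
  by rewrite -state_lawE state_law0.
rewrite -(nneseries_addn 1%N)//.
by apply: eq_eseriesr => n _; rewrite addn1 -state_lawE state_lawS.
Qed.

End step_law.

Section stationary_law.
Context {R : realType} {X A : ptopologicalType} {J : nat}.
Variable M : impulse_model R X A J.
Local Notation state := (state X).
Local Notation action := (action R A).
Local Notation strategy := (@strategy R X A).
Hypothesis rA : @real_retract R _ action.

Lemma step_law_rectangle (pi : strategy) (x : state) (g : nat -> state -> {measure set action -> \bar R}) n G U :
  (forall h V, measurable V -> pi n h V = g n h.2 V) ->
  measurable_fun setT ((g n) ^~ U) ->
  measurable G -> measurable U ->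
  step_law M pi x n (G `*` U) = \int[state_law M pi x n]_(y in G) g n y U.
Proof.
move=> gE mg mG mU; have [_ h _] := lawP M pi x rA.
have mG' : measurable [set hh : @history R X A n | G hh.2].
  exact: (measurable_preim measurable_snd mG).
have := h n _ U mG' mU; move=> e; apply: etrans e _.
have mgf : measurable_fun setT (fun p : state * action => g n p.1 U).
  exact: (measurableT_comp mg measurable_fst).
have mGf : measurable (fst @^-1` G : set (state * action)).
  exact: (measurable_preim measurable_fst mG).
apply/esym; apply: etrans (ge0_integral_image_measure _ _ mG mg _) _ => //.
apply: etrans (ge0_integral_image_measure _ _ mGf mgf _) _ => //.
by apply: eq_integral => w _; rewrite gE.
Qed.

(** Randomizing [k] exhibits the right-hand side as the image of a product measure, hence as a
    measure in U; then rectangles suffice, where the defining property of the law applies. *)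
Lemma stationary_step_law (k : R.-pker state ~> action) (x : state) n U :
  measurable U ->
  step_law M (stationary k) x n U =
  \int[state_law M (stationary k) x n]_y k y (xsection U y).
Proof.
move=> mU; have [|V mV|xi mxi xiE] := @randomization R _ _ _ _ k rA.
- by move=> y; exact: prob_kernel.
- exact: measurable_kernel.
have mxi2 : measurable_fun setT (fun p : state * R => (p.1, xi p)).
  by apply: measurable_fun_pair => //; exact: measurable_fst.
pose m := state_law M (stationary k) x n.
transitivity (image_measure (m \x unif) mxi2 U); last first.
  apply: eq_integral => y _ /=; rewrite xiE; last exact: measurable_xsection.
  by congr (unif _); rewrite !xsectionE.
apply: (@measure_unique_rectangles R) => // [|G V mG mV].
  by rewrite step_lawT ltry.
rewrite (@step_law_rectangle _ _ (fun _ => k))//; last exact: measurable_kernel.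
rewrite -/m integral_mkcond; apply: eq_integral => y _ /=.
rewrite patchE xsectionE; case: ifPn => yG.
  rewrite xiE//; congr (unif _); apply/seteqP; split => u //=; last by case.
  by move=> Vu; split => //; exact: set_mem.
rewrite (_ : _ @^-1` _ = set0) ?measure0//.
by apply/seteqP; split => // u [/= Gy _]; move: yG; rewrite mem_set.
Qed.

Fixpoint orbit (g : nat -> state -> action) (x : state) (n : nat) : state :=
  if n is k.+1 then next_state M (orbit g x k) (g k (orbit g x k)) else x.

(** The selector may depend on the step, which covers both the strategy f and a sequence of actions
    planned in advance along one path. *)
Lemma deterministic_step_law (pi : strategy) (g : nat -> state -> action) (x : state) :
  (forall n, measurable_fun setT (g n)) ->
  (forall n h V, measurable V -> pi n h V = \d_(g n h.2) V) ->
  forall n U, measurable U ->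
  step_law M pi x n U = \d_(orbit g x n, g n (orbit g x n)) U.
Proof.
move=> mg piE.
have rect n : (forall G, measurable G -> state_law M pi x n G = \d_(orbit g x n) G) ->
    forall U, measurable U -> step_law M pi x n U = \d_(orbit g x n, g n (orbit g x n)) U.
  move=> sE; apply: (@measure_unique_rectangles R) => [|G V mG mV].
    by rewrite step_lawT ltry.
  have mgV := measurable_preim (mg n) mV.
  rewrite (@step_law_rectangle pi x (fun n y => \d_(g n y)) n G V (piE n))//;
    last first.
    rewrite (_ : (fun y => _) = EFin \o (\1_V \o g n))//.
  apply/measurable_EFinP; apply: measurableT_comp; first exact: measurable_indic.
  exact: mg.
  rewrite (eq_integral (fun y => (\1_(g n @^-1` V) y)%:E))//.
  rewrite integral_indic// sE; last exact: measurableI.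
  rewrite !diracE; suff -> : (orbit g x n \in g n @^-1` V `&` G) =
      ((orbit g x n, g n (orbit g x n)) \in G `*` V) by [].
  by apply/idP/idP => /set_mem[? ?]; exact/mem_set.
suff sE n : forall G, measurable G -> state_law M pi x n G = \d_(orbit g x n) G.
  by move=> n; apply: rect; exact: sE.
elim: n => [|n ih] G mG; first exact: state_law0.
rewrite state_lawS//.
have mnG := measurable_preim (measurable_next_state M) mG.
rewrite (eq_integral (fun p => (\1_((fun p : state * action => next_state M p.1 p.2 : state) @^-1` G) p)%:E))//.
by rewrite integral_indic// setIT rect.
Qed.

Lemma deterministic_aggregate_cost (pi : strategy) (g : nat -> state -> action) (x : state) :
  (forall n, measurable_fun setT (g n)) ->
  (forall n h V, measurable V -> pi n h V = \d_(g n h.2) V) ->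
  aggregate_cost M pi x =
  \sum_(0 <= n <oo) \sum_(j < J.+1) stage_cost M j (orbit g x n) (g n (orbit g x n)).
Proof.
move=> mg piE.
pose h (p : state * action) := \sum_(j < J.+1) stage_cost M j p.1 p.2.
have mh : measurable_fun setT h.
  by apply: emeasurable_sum => j; exact: measurable_stage_cost.
have h0 p : 0 <= h p by apply: sume_ge0 => j _; exact: stage_cost_ge0.
rewrite /aggregate_cost (@expectation_series _ _ _ _ M pi x h)//.
apply: eq_eseriesr => n _.
rewrite (@eq_measure_integral _ _ _ _ (\d_(orbit g x n, g n (orbit g x n)))).
  by rewrite integral_dirac// diracT mul1e.
by move=> U mU _; exact: deterministic_step_law.
Qed.

End stationary_law.

(** * The set V *)

Section costly.
Context {R : realType} {X A : ptopologicalType} {J : nat}.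
Variable M : impulse_model R X A J.
Hypothesis hII : condition_II M.
Local Notation state := (state X).
Local Notation action := (action R A).
Local Notation nonneg := (set_type [set t : R | (0 <= t)%R]).

Definition before (s : R) (t : extended_time R) : Prop :=
  if t is Some u then (s < \val u)%R else True.

Lemma nbhs_before (s : R) (t : extended_time R) : before s t -> nbhs t (before s).
Proof.
case: t => [u su|_].
  apply: (@filterS _ _ _ [set t : extended_time R | (s < time_to_real t)%R /\ t <> None]).
    by move=> [v []|[]].
  by apply: open_nbhs_nbhs; split; [exact: open_time_gt|].
(* Neighbourhoods of infinity are given by closed compact sets of finite times. The retraction [r]
   of the line onto [0, +oo[ makes [C] the image of a segment, hence compact. *)
have r0 (v : R) : [set t : R | (0 <= t)%R] (Num.max 0%R v) by rewrite /= le_max lexx.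
pose r (v : R) : nonneg := exist _ (Num.max 0%R v) (mem_set (r0 v)).
have cr : continuous r.
  apply: continuous_comp_initial.
  have -> : set_val \o r = fun v => Num.max 0%R v by [].
  by move=> v; apply: continuous_max; [exact: cst_continuous|exact: cvg_id].
have rE (u : nonneg) : r (\val u) = u.
  by apply: val_inj => /=; apply/max_idPr; exact: (set_mem (valP u)).
pose C : set nonneg := [set u | (\val u <= Num.max 0 s)%R].
exists C; last first.
  move=> _ [[u /= /negP + <-]|-> //]; rewrite -ltNge /before; apply: le_lt_trans.
  by rewrite le_max lexx orbT.
split.
  rewrite (_ : C = r @` (`[0%R, Num.max 0%R s]%classic)).
    apply: continuous_compact; last exact: segment_compact.
    exact: continuous_subspaceT.
  apply/seteqP; split => [u us|_ [v /= + <-]].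
    exists (\val u); last exact: rE.
    by rewrite /= in_itv/= us andbT; exact: (set_mem (valP u)).
  by rewrite in_itv/= /C /= => /andP[v0]; rewrite (max_idPr v0).
rewrite -[C]/(set_val @^-1` [set v | (v <= Num.max 0 s)%R]).
apply: closed_comp; last exact: closed_le.
by move=> u _; exact: initial_continuous.
Qed.

Lemma flow_near (x : X) (t : R) (W : set X) : (0 <= t)%R -> nbhs (flow M x t) W ->
  exists Nx Nt, [/\ nbhs x Nx, nbhs t Nt &
    forall y s, Nx y -> Nt s -> (0 <= s)%R -> W (flow M y s)].
Proof.
move=> t0 nW; have [_ _ cflow _ _] := hII.
have : nbhs ((x, t) : subspace [set p : X * R | (0 <= p.2)%R])
  ((fun p : X * R => flow M p.1 p.2) @^-1` W) by exact: cflow.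
rewrite /nbhs /= -nbhs_subspace_in// => -[[Nx Nt] [/= nNx nNt] NW].
by exists Nx, Nt; split => // y s Ny Ns s0; exact: (NW (y, s)).
Qed.

(** The neighbourhoods are kept apart because [not_costly] covers the times and impulses by
    compactness while the state only shrinks towards x. *)
Definition holds_near (P : X -> extended_time R -> A -> Prop)
    (x : X) (t : extended_time R) (a : A) : Prop :=
  exists Nx Nt Na, [/\ nbhs x Nx, nbhs t Nt, nbhs a Na &
    forall y s b, Nx y -> Nt s -> Na b -> P y s b].

Lemma some_time_near (x : X) (t : nonneg) (a : A) (W : set (X * A)) :
  nbhs (flow M x (\val t), a) W ->
  holds_near (fun y s b => exists2 u : nonneg, s = Some u & W (flow M y (\val u), b))
    x (Some t) a.
Proof.
move=> -[[W1 W2] [/= nW1 nW2] W12].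
have [Nx [Nt [nNx nNt NW]]] := flow_near (set_mem (valP t)) nW1.
exists Nx, (Some @` (set_val @^-1` Nt)), W2; split => //.
  apply: one_point_compactification_some_nbhs.
  exact: (@initial_continuous _ _ (set_val : nonneg -> R) t).
move=> y _ b Ny [u Nu <-] W2b; exists u => //; apply: W12; split => //=.
by apply: NW => //; exact: (set_mem (valP u)).
Qed.

Lemma gcost_integral_pos (j : 'I_J.+1) (x : X) (D : set R) :
  0 < \int[lebesgue_measure]_(u in D) (gcost M j (flow M x u))%:E ->
  exists2 u, D u & (0 < gcost M j (flow M x u))%R.
Proof.
move=> c0; apply: contrapT => h; move: c0.
rewrite integral0_eq ?ltxx// => u Du; apply/eqP;
  rewrite eqe eq_le gcost_ge0 andbT leNgt.
by apply/negP => gu; apply: h; exists u.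
Qed.

Lemma measurable_gcost_flow j (x : X) (D : set R) :
  D `<=` [set u | (0 <= u)%R] ->
  measurable_fun (D : set (measurableTypeR R)) (fun u => (gcost M j (flow M x u))%:E).
Proof.
move=> D0.
have mid : measurable_fun setT (id : measurableTypeR R -> R) by move=> _ Y mY;
  rewrite setTI.
have : measurable_fun (setT : set (measurableTypeR R))
    (fun u => (gcost M j (flow M x (Num.max 0%R u)))%:E).
  apply/measurable_EFinP; apply: (measurableT_comp (measurable_gcost M j)).
  apply: (measurableT_comp (measurable_flow_max M) (g := fun u : measurableTypeR R => (x : borel X, u : R))).
  by apply: measurable_fun_pair => //; exact: measurable_cst.
move=> /(measurable_funS measurableT (@subsetT _ D)).
by apply: eq_measurable_fun => u /[!inE] /D0 /= u0; rewrite (max_idPr u0).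
Qed.

(** Either the running cost is positive at some time u before t, and by lower semicontinuity it
    stays above a constant on a short interval after u for all nearby states; or t is finite and the
    impulse cost is positive, and lower semicontinuity applies to it directly. *)
Lemma cost_near j (x : X) (t : extended_time R) (a : A) :
  0 < stage_cost M j (Some x) (t, a) ->
  exists2 e : R, (0 < e)%R &
    holds_near (fun y s b => e%:E < stage_cost M j (Some y) (s, b)) x t a.
Proof.
move=> c0; have [_ cjump cflow ilsc glsc] := hII.
have int0 y (D : set R) : 0 <= \int[lebesgue_measure]_(u in D) (gcost M j (flow M y u))%:E.
  by apply: integral_ge0 => u _; rewrite lee_fin gcost_ge0.
have [[u [u0 ut gu]]|noint] := pselect (exists u, [/\ (0 <= u)%R, before u t &
    (0 < gcost M j (flow M x u))%R]).
  pose d := (gcost M j (flow M x u) / 2)%R.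
  have d0 : (0 < d)%R by rewrite divr_gt0.
  have [|W nW gW] := glsc j (flow M x u) d.
    by rewrite lte_fin /d; lra.
  have [Nx [Nu [nNx nNu NW]]] := flow_near u0 nW.
  have /nbhs_ballP[r /= r0 rN] := nNu.
  (* Strictness of v before t matters: every time close to t then still exceeds v, so the interval
     [u, v] is always paid for. *)
  have [v [uv vr vt]] : exists v, [/\ (u < v)%R, (v < u + r)%R & before v t].
    case: t ut {c0} => [t ut|_]; last by exists (u + r / 2)%R; split => //; lra.
    have {}ut : (u < \val t)%R := ut.
    rewrite /before; move: (\val t : R) ut => tv ut.
    exists (Num.min ((u + tv) / 2) (u + r / 2))%R; split.
    - by rewrite lt_min; apply/andP; split; lra.
    - by rewrite gt_min; apply/orP; right; lra.
    - by rewrite gt_min; apply/orP; left; lra.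
  (* The interval [u, v] costs at least d (v - u); half of it makes the bound strict. *)
  exists (d * (v - u) / 2)%R; first by rewrite divr_gt0// mulr_gt0// subr_gt0.
  exists Nx, (before v), setT; split => //; [exact: nbhs_before|exact: filterT|].
  move=> y s b Ny vs _.
  have lower (D : set R) : measurable (D : set (measurableTypeR R)) ->
      D `<=` [set u | (0 <= u)%R] -> `[u, v]%classic `<=` D ->
      (d * (v - u) / 2)%:E < \int[lebesgue_measure]_(w in D) (gcost M j (flow M y w))%:E.
    move=> mD D0 uvD.
    apply: (@lt_le_trans _ _ (\int[lebesgue_measure]_(w in `[u, v]%classic) (cst d%:E) w)).
      rewrite integral_cst//= lebesgue_measure_itv/= lte_fin uv -EFinD -EFinM lte_fin.
      have : (0 < d * (v - u))%R by rewrite mulr_gt0// subr_gt0.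
      by move: (d * (v - u))%R => q; lra.
    apply: (@le_trans _ _ (\int[lebesgue_measure]_(w in `[u, v]%classic) (gcost M j (flow M y w))%:E)).
      apply: ge0_le_integral => //=.
      - by move=> w _; rewrite lee_fin ltW.
      - by apply: measurable_gcost_flow; exact: subset_trans D0.
      - move=> w; rewrite in_itv/= => /andP[uw wv]; rewrite ltW// gW//.
        apply: NW => //; last exact: le_trans uw.
        by apply: rN; rewrite /ball/= ltr_norml; apply/andP; split; lra.
    apply: ge0_subset_integral => //; first exact: measurable_gcost_flow.
    by move=> w _; rewrite lee_fin gcost_ge0.
  case: s vs => [s /= vs|_].
    apply: (@lt_le_trans _ _ (\int[lebesgue_measure]_(w in `[0%R, \val s]%classic) (gcost M j (flow M y w))%:E)).
      apply: lower => //.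
        by move=> w /=; rewrite in_itv/= => /andP[].
      move=> w /=; rewrite !in_itv/= => /andP[uw wv]; apply/andP; split.
        exact: le_trans uw.
      by rewrite (le_trans wv)// ltW.
    by rewrite leeDl// lee_fin icost_ge0.
  apply: lower => //.
    by move=> w /=; rewrite in_itv/= andbT.
  by move=> w /=; rewrite !in_itv/= andbT => /andP[uw _]; exact: le_trans uw.
case: t c0 noint => [t|] /= c0 noint; last first.
  have [u /=] := gcost_integral_pos c0.
  by rewrite in_itv/= andbT => u0 gu; exfalso; apply: noint; exists u.
move: c0; rewrite (_ : \int[_]_(_ in _) _ = 0) ?add0e; last first.
  (* Only times strictly before t are known to be free of running cost; the right endpoint is a null
     set. *)
  rewrite -integral_itv_bndo_bndc; last first.
    by apply: measurable_gcost_flow => u /=; rewrite in_itv/= => /andP[].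
  apply: integral0_eq => u /=; rewrite in_itv/= => /andP[u0 ut].
  apply/eqP; rewrite eqe eq_le gcost_ge0 andbT leNgt; apply/negP => gu.
  by apply: noint; exists u.
rewrite lte_fin => i0; set e := (icost M j (flow M x (\val t)) a / 2)%R.
have [|W nW iW] := ilsc j (flow M x (\val t), a) e.
  by rewrite lte_fin /= /e; lra.
exists e; first by rewrite divr_gt0.
have [Nx [Nt [Na [nNx nNt nNa N]]]] := some_time_near nW.
exists Nx, Nt, Na; split => // y s b Ny Ns Nb.
have [u -> Wu] := N y s b Ny Ns Nb; rewrite /=.
by apply: (lt_le_trans (iW _ Wu)); rewrite leeDr.
Qed.

(** The interior makes every level open, which the continuity of the jump can then use at the next
    level. The threshold decreases with the level, so the levels increase. *)
Fixpoint costly (k : nat) : set X :=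
  if k is k'.+1 then
    interior [set y | forall t a,
      (exists j, (k'.+1%:R^-1)%:E < stage_cost M j (Some y) (t, a)) \/
      (exists2 z, next_state M (Some y) (t, a) = Some z & costly k' z)]
  else set0.

Lemma open_costly k : open (costly k).
Proof. by case: k => [|k]; [exact: open0|exact: open_interior]. Qed.

Lemma costlyS k : costly k `<=` costly k.+1.
Proof.
elim: k => [//|k ih]; apply: interiorS => y h t a.
have [[j c]|[z e cz]] := h t a; [left|by right; exists z => //; exact: ih].
exists j; apply: le_lt_trans c; rewrite lee_fin lef_pV2 ?posrE//.
by rewrite ler_nat.
Qed.

Lemma costly_mono m n : (m <= n)%N -> costly m `<=` costly n.
Proof.
elim: n => [|n ih]; first by rewrite leqn0 => /eqP ->.
rewrite leq_eqVlt => /orP[/eqP -> //|/ih mn x Cx].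
by apply: costlyS; exact: mn.
Qed.

(** Otherwise each action at x has a positive cost or leads into some level, and this persists
    nearby with a level valid on a neighbourhood. Compactness of the action space gives one level k
    and one neighbourhood of x for all actions, so x lies in the interior defining level k + 1. *)
Lemma not_costly (x : X) : ~ (\bigcup_k costly k) x ->
  exists t a, (forall j, stage_cost M j (Some x) (t, a) = 0) /\
    forall z, next_state M (Some x) (t, a) = Some z -> ~ (\bigcup_k costly k) z.
Proof.
move=> nx; apply: contrapT => h; apply: nx.
have [cA cjump cflow ilsc glsc] := hII.
pose good (y : X) (k : nat) (b : extended_time R * A) :=
  (exists j, (k.+1%:R^-1)%:E < stage_cost M j (Some y) b) \/
  (exists2 z, next_state M (Some y) b = Some z & costly k z).
have local (t : extended_time R) (a : A) : exists k0, 
    holds_near (fun y s b => forall k, (k0 <= k)%N -> good y k (s, b)) x t a.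
  have [[j c0]|noc] := pselect (exists j, 0 < stage_cost M j (Some x) (t, a)).
    have [e e0 [Nx [Nt [Na [nNx nNt nNa N]]]]] := cost_near c0.
    (* From this level on, 1 / (k + 1) < e. *)
    exists (Num.truncn e^-1), Nx, Nt, Na; split => // y s b Ny Ns Nb k ek.
    left; exists j; apply: lt_trans (N y s b Ny Ns Nb); rewrite lte_fin.
    rewrite -[ltRHS]invrK ltf_pV2 ?posrE ?invr_gt0//.
    by rewrite (lt_le_trans (truncnS_gt _))// ler_nat ltnS.
  have [z e [k _ cz]] : exists2 z, next_state M (Some x) (t, a) = Some z & (\bigcup_k costly k) z.
    apply: contrapT => h'; apply: h; exists t, a; split.
      move=> j; apply/eqP; rewrite eq_le stage_cost_ge0 andbT leNgt;
        apply/negP => c0.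
      by apply: noc; exists j.
    by move=> z e cz; apply: h'; exists z.
  case: t e noc => [t|//] /= [ez] _.
  have nW : nbhs (flow M x (\val t), a) ((fun p : X * A => jump M p.1 p.2) @^-1` costly k).
    apply: cjump; rewrite /= ez; apply: open_nbhs_nbhs; split => //;
      exact: open_costly.
  have [Nx [Nt [Na [nNx nNt nNa N]]]] := some_time_near nW.
  exists k, Nx, Nt, Na; split => // y s b Ny Ns Nb k' kk'.
  have [u -> Wu] := N y s b Ny Ns Nb; right.
  by exists (jump M (flow M y (\val u)) b) => //; exact: costly_mono Wu.
have cB : compact [set: extended_time R * A].
  by rewrite -setXTT; apply: compact_setX => //;
    exact: one_point_compactification_compact.
(* Near-covering compactness with the pair (state, level) as parameter: the state tends to x while
   the level tends to infinity. *)
move/compact_near_coveringP : cB => /(_ _ (filter_prod (nbhs x) \oo)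
  (fun p b => good p.1 p.2 b) _).
case.
- move=> [t a] _; have [k0 [Nx [Nt [Na [nNx nNt nNa N]]]]] := local t a.
  exists ((Nt `*` Na), (Nx `*` [set k | (k0 <= k)%N])).
    split; first by exists (Nt, Na).
    by exists (Nx, [set k | (k0 <= k)%N]) => //; split => //; exists k0.
  by move=> [[s b] [y k]] /= [[Ns Nb] [Ny k0k]]; exact: N.
- move=> [Nx K] [/= nNx [k _ kK]] NK; exists k.+1 => //=.
  apply: filterS nNx => y Ny t a.
  have yk : (Nx `*` K) (y, k) by split => //; exact: kK (leqnn k).
  exact: (NK _ yk (t, a) I).
Qed.

End costly.

Section selector.
Context {R : realType} {X A : ptopologicalType} {J : nat}.
Variable M : impulse_model R X A J.
Local Notation state := (state X).
Local Notation action := (action R A).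
Local Notation V := (Vset M).
Hypothesis rA : @real_retract R _ action.
Hypothesis hII : condition_II M.
Variables (f : state -> action) (mf : measurable_fun setT f).
Hypothesis hf : optimal_selector M mf.

Let orb (x : state) n : state := orbit M (fun _ => f) x n.

Let optimal_costE (x : state) : optimal_aggregate_cost M x =
  \sum_(0 <= n <oo) \sum_(j < J.+1) stage_cost M j (orb x n) (f (orb x n)).
Proof.
rewrite -hf.1 (@deterministic_aggregate_cost _ _ _ _ M rA _ (fun _ => f))//.
Qed.

Let cost_ge0 (x : state) (b : action) : 0 <= \sum_(j < J.+1) stage_cost M j x b.
Proof. by apply: sume_ge0 => j _; exact: stage_cost_ge0. Qed.

(** By property (i) the infimum over all strategies is the cost along the orbit of f, a series of
    measurable functions of the initial state. *)
Lemma measurable_Vset : measurable V.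
Proof.
have morb n : measurable_fun setT (fun x : state => orb x n).
  elim: n => [|n ih]; first exact: measurable_id.
  apply: (measurableT_comp (measurable_next_state M) (g := fun x => (orb x n, f (orb x n)))).
  by apply: measurable_fun_pair => //; exact: measurableT_comp.
have mcost : measurable_fun setT (fun x : state =>
    \sum_(0 <= n <oo) \sum_(j < J.+1) stage_cost M j (orb x n) (f (orb x n))).
  apply: ge0_emeasurable_sum => [n x _ _|n _]; first exact: cost_ge0.
  apply: emeasurable_sum => j.
  apply: (measurableT_comp (@measurable_stage_cost _ _ _ _ M j) (g := fun x => (orb x n, f (orb x n)))).
  by apply: measurable_fun_pair => //; exact: measurableT_comp.
have := emeasurable_fun_o_infty measurableT mcost 0.
rewrite setTI; congr (measurable _); apply/funext => x /=.
by rewrite /Vset /= optimal_costE.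
Qed.

(** The optimal cost is a series of nonnegative terms along the orbit of f; it vanishes, so its
    first term does. Property (ii) keeps the orbit outside V. *)
Lemma selector_outside_V (x : state) : ~ V x ->
  (forall j, stage_cost M j x (f x) = 0) /\ ~ V (next_state M x (f x)).
Proof.
move=> nV; split; last first.
  move=> Vn; have := hf.2 x nV; rewrite transitionE indicE mem_set// => -[] /eqP.
  by rewrite oner_eq0.
have : optimal_aggregate_cost M x <= 0 by rewrite leNgt; exact/negP.
rewrite optimal_costE nneseries_recl// => le0 j.
have : \sum_(j < J.+1) stage_cost M j x (f x) <= 0.
  apply: le_trans le0; rewrite leeDl//; apply: nneseries_ge0 => n _ _;
    exact: cost_ge0.
move=> s0; apply/eqP; rewrite eq_le stage_cost_ge0 andbT; apply: le_trans s0.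
by rewrite (bigD1 j)//= leeDl//; apply: sume_ge0 => i _; exact: stage_cost_ge0.
Qed.

(** Test the definition of [costly] on the action of f: outside V it is free and does not enter V,
    contradicting both alternatives. *)
Lemma costly_sub_V k y : costly M k y -> V (Some y).
Proof.
elim: k y => [//|k ih] y /interior_subset h; apply: contrapT => nV.
have [c0 nnext] := selector_outside_V nV.
have [[j]|[z e /ih Vz]] := h (f (Some y)).1 (f (Some y)).2.
  by rewrite -surjective_pairing c0 lte_fin ltNge invr_ge0 ler0n.
by apply: nnext; move: e; rewrite -surjective_pairing => ->.
Qed.

(* Outside every costly set one can move forever at no cost; as the dynamics is
   deterministic, the actions along that single path form a strategy. *)
Lemma V_sub_costly (x : state) : V x -> exists2 y, x = Some y & (\bigcup_k costly M k) y.
Proof.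
apply: contraPP => nx.
pose Z (z : state) := ~ exists2 y, z = Some y & (\bigcup_k costly M k) y.
have ex z : exists b : action, Z z ->
    (forall j, stage_cost M j z b = 0) /\ Z (next_state M z b).
  have [Zz|nZ] := pselect (Z z); last by exists point.
  case: z Zz => [y|] Zz; last by exists point => _; split => // -[].
  have [|t [a [c0 nz]]] := @not_costly _ _ _ _ M hII y.
    by move=> cy; apply: Zz; exists y.
  by exists (t, a) => _; split => // -[z e cz]; exact: nz e cz.
have [b bP] := choice ex.
pose xs := fix xs n : state := if n is k.+1 then next_state M (xs k) (b (xs k)) else x.
have Zxs n : Z (xs n) by elim: n => [//|n ih] /=; exact: (bP _ ih).2.
pose g (n : nat) : state -> action := fun _ => b (xs n).
pose pi : @strategy R X A := fun n =>
  kdirac (@measurable_cst _ _ (@history R X A n) action setT (b (xs n))).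
have orbE n : orbit M g x n = xs n by elim: n => [//|n /= ->].
have : aggregate_cost M pi x = 0.
  rewrite (@deterministic_aggregate_cost _ _ _ _ M rA pi g)//.
    rewrite eseries0// => n _ _; rewrite big1// => j _; rewrite orbE.
    by have [c0 _] := bP _ (Zxs n); exact: c0.
  by move=> n; exact: measurable_cst.
move=> c0; rewrite /Vset /= => lt0.
have : optimal_aggregate_cost M x <= aggregate_cost M pi x.
  by apply: ereal_inf_lbound; exists pi.
by rewrite c0 leNgt lt0.
Qed.

Definition costly_states (k : nat) : set state := Some @` costly M k.

Lemma measurable_costly_states k : measurable (costly_states k).
Proof. by apply: open_measurable_borel; apply: open_Some; exact: open_costly. Qed.

Lemma V_bigcup : V = \bigcup_k costly_states k.
Proof.
apply/seteqP; split => [x /V_sub_costly[y -> [k _ cy]]|_ [k _ [y cy <-]]].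
  by exists k => //; exists y.
exact: costly_sub_V cy.
Qed.

End selector.

(** * Comparison of measures *)

Section le_measure_integral.
Context {R : realType} d (T : measurableType d).
Import HBNNSimple.

(** The measures are compared inside D only: a simple function below f on D has its nonzero levels
    in D. *)
Lemma le_measure_integral (m1 m2 : {measure set T -> \bar R}) (D : set T)
    (f : T -> \bar R) :
  (forall A, measurable A -> A `<=` D -> m1 A <= m2 A) ->
  (forall x, D x -> 0 <= f x) ->
  \int[m1]_(x in D) f x <= \int[m2]_(x in D) f x.
Proof.
move=> m12 f0; rewrite !ge0_integralE//.
apply: ge_ereal_sup => _ [h hfD <-].
apply: (@le_trans _ _ (sintegral m2 h)); last by apply: ereal_sup_ubound; exists h.
rewrite !sintegralE; apply: lee_fsum => // r _.
have [hrD|hrD] := pselect (h @^-1` [set r] `<=` D).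
  have [r0|r0] := leP 0%R r; first by apply: lee_wpmul2l => //; exact: m12.
  rewrite (_ : h @^-1` [set r] = set0) ?measure0//.
  apply/seteqP; split => // x /= hx.
  by have : (0 <= h x)%R by []; rewrite hx leNgt r0.
suff -> : r = 0%R by rewrite !mul0e.
apply: contra_notP hrD => /eqP r0 t/= htr; have := hfD t.
rewrite /patch/=; case: ifPn; first by rewrite inE.
move=> tD; move: r0; rewrite -htr => ht0.
by rewrite le_eqVlt eqe (negbTE ht0)/= lte_fin// ltNge// fun_ge0.
Qed.

End le_measure_integral.

Section comparison.
Context {R : realType} {X A : ptopologicalType} {J : nat}.
Variable M : impulse_model R X A J.
Local Notation state := (state X).
Local Notation action := (action R A).
Local Notation V := (Vset M).
Local Notation VB := (Vset M `*` [set: action]).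
Hypothesis rA : @real_retract R _ action.
Hypothesis hII : condition_II M.
Variables (f : state -> action) (mf : measurable_fun setT f).
Hypothesis hf : optimal_selector M mf.
Variable x0 : X.
Let s0 : state := Some x0.

Let mV : measurable V. Proof. exact: (measurable_Vset rA hf). Qed.

Lemma measurable_VB : measurable VB.
Proof. exact: measurableX. Qed.
Hint Resolve measurable_VB : core.

Let mnext (G : set state) : measurable G ->
  measurable [set p : state * action | G (next_state M p.1 p.2)].
Proof. exact: (measurable_preim (measurable_next_state M)). Qed.

Lemma integral_transition (m : {measure set (state * action) -> \bar R})
    (D : set (state * action)) (G : set state) : measurable D -> measurable G ->
  \int[m]_(p in D) transition M p.1 p.2 G =
  m (D `&` [set p | G (next_state M p.1 p.2)]).
Proof.
move=> mD mG.
rewrite (eq_integral (fun p => (\1_[set p : state * action | G (next_state M p.1 p.2)] p)%:E)); last first.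
  move=> p _; rewrite transitionE !indicE.
  suff -> : (next_state M p.1 p.2 \in G) =
    (p \in [set p : state * action | G (next_state M p.1 p.2)]) by [].
  by apply/idP/idP => /set_mem h; exact/mem_set.
rewrite integral_indic//; last exact: mnext.
by rewrite setIC.
Qed.

(* Both programs imply this one-sided balance, with equality for LP2. *)
Definition subbalanced (mu : {measure set (state * action) -> \bar R}) : Prop :=
  forall G : set state, measurable G -> G `<=` V ->
    \d_s0 G + \int[mu]_(p in VB) transition M p.1 p.2 G <= mu (G `*` setT).

(** Dropping the mass that enters G from outside V only lowers the right-hand side of the
    balance. *)
Lemma feasible_LP1_subbalanced d mu : feasible_LP1 M x0 d mu -> subbalanced mu.
Proof.
move=> [h _] G mG _; rewrite h// leeD2l// ge0_subset_integral//.
- exact: measurable_transition.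
Qed.

(** Pairs over level k + 1 either cost more than 1 / (k + 1), and have finite mass by Markov's
    inequality, or lead to level k, and by balance their mass is at most the marginal mass of that
    level. *)
Lemma costly_marginal_finite mu k : subbalanced mu ->
  (forall j, cost_integral M VB mu j < +oo) ->
  mu (costly_states M k `*` setT) < +oo.
Proof.
move=> bal coo; have mC k' := @measurable_costly_states R X A J M k'.
have CV k' : costly_states M k' `<=` V by move=> _ [y cy <-];
  exact: (costly_sub_V rA hf cy).
elim: k => [|k ih].
  rewrite (_ : _ `*` _ = set0) ?measure0 ?ltry//.
  by apply/seteqP; split => // -[s b] [[]].
pose e : R := (k.+1%:R^-1)%R.
have e0 : (0 < e)%R by rewrite invr_gt0.
pose E j : set (state * action) := VB `&` [set p | e%:E < stage_cost M j p.1 p.2].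
have mE j : measurable (E j).
  by apply: emeasurable_fun_o_infty => //; apply: measurable_funTS;
    exact: measurable_stage_cost.
have Eoo j : mu (E j) < +oo.
  have : e%:E * mu (E j) < +oo.
    apply: le_lt_trans (coo j); rewrite -integral_cst//.
    apply: (@le_trans _ _ (\int[mu]_(p in E j) stage_cost M j p.1 p.2)).
      apply: ge0_le_integral => //.
      - by move=> p _; rewrite lee_fin ltW.
      - by apply: measurable_funTS; exact: measurable_stage_cost.
      - by move=> p [_ /ltW].
    apply: ge0_subset_integral => //.
    - by apply: measurable_funTS; exact: measurable_stage_cost.
    - by move=> p _; exact: stage_cost_ge0.
    - exact: subIsetl.
  by apply: contraTT; rewrite -!leNgt !leye_eq => /eqP ->;
    rewrite gt0_muley ?lte_fin.
have mG := mnext (mC k).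
have Goo : mu (VB `&` [set p | costly_states M k (next_state M p.1 p.2)]) < +oo.
  apply: le_lt_trans ih; rewrite -integral_transition//.
  by apply: le_trans (bal _ (mC k) (CV k)); rewrite leeDr.
have sub : costly_states M k.+1 `*` setT `<=`
    (\big[setU/set0]_(j < J.+1) E j) `|`
    (VB `&` [set p | costly_states M k (next_state M p.1 p.2)]).
  move=> [s [t a]] [/= Cs _]; have Vs : VB (s, (t, a)) by split => //=; exact: CV Cs.
  case: Cs => y /interior_subset/(_ t a)[[j c]|[z ez cz]] ys.
    by left; rewrite (bigD1 j)//=; left; split => //=; rewrite -ys.
  by right; split => //=; rewrite -ys; exists z => //; rewrite ez.
apply: (@le_lt_trans _ _ (mu (\big[setU/set0]_(j < J.+1) E j) +
    mu (VB `&` [set p | costly_states M k (next_state M p.1 p.2)]))).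
  have mU : measurable (\big[setU/set0]_(j < J.+1) E j) by exact: bigsetU_measurable.
  have mI := measurableI _ _ measurable_VB mG.
  apply: le_trans (measureU2 _ _ _) => //; apply: le_measure; rewrite ?inE//.
    by apply: measurableX => //; exact: mC.
  exact: measurableU.
apply: lte_add_pinfty => //.
suff [] : measurable (\big[setU/set0]_(j < J.+1) E j) /\
    mu (\big[setU/set0]_(j < J.+1) E j) < +oo by [].
apply: (big_ind (fun S => measurable S /\ mu S < +oo)) => //.
  by split => //; rewrite measure0 ltry.
move=> S1 S2 [mS1 S1oo] [mS2 S2oo]; split; first exact: measurableU.
by apply: le_lt_trans (measureU2 _ _ _) _ => //; exact: lte_add_pinfty.
Qed.

Lemma VB_bigcup : VB = \bigcup_k (costly_states M k `*` setT).
Proof. by rewrite (V_bigcup rA hII hf) setX_bigcupl. Qed.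

Variable k : R.-pker state ~> action.
Hypothesis k_outside : forall x, ~ V x -> forall U, measurable U -> k x U = \d_(f x) U.

Local Notation pi := (stationary k).
Local Notation occ := (occupation M pi s0).

(** Pairs outside V at which f would never be acting: those that cost something or enter V. As [k]
    follows f there, they form a null set, which replaces almost sure statements about paths. *)
Definition wasteful : set (state * action) := [set p | ~ V p.1 /\
  (0 < \sum_(j < J.+1) stage_cost M j p.1 p.2 \/ V (next_state M p.1 p.2))].

Lemma measurable_wasteful : measurable wasteful.
Proof.
rewrite (_ : wasteful = (~` V `*` setT) `&`
  ([set p | 0 < \sum_(j < J.+1) stage_cost M j p.1 p.2] `|`
   [set p | V (next_state M p.1 p.2)])).
  apply: measurableI; first by apply: measurableX => //; exact: measurableC.
  apply: measurableU; last exact: mnext.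
  have h : measurable_fun setT (fun p : state * action => \sum_(j < J.+1) stage_cost M j p.1 p.2).
    by apply: emeasurable_sum => j; exact: measurable_stage_cost.
  by have := emeasurable_fun_o_infty measurableT h 0; rewrite setTI.
by apply/seteqP; split => p; [move=> [? ?]; split|move=> [[? _] ?]; split].
Qed.

Lemma step_law_wasteful n : step_law M pi s0 n wasteful = 0.
Proof.
rewrite stationary_step_law//; last exact: measurable_wasteful.
apply: integral0_eq => x _; have [Vx|nVx] := pselect (V x).
  rewrite (_ : xsection _ _ = set0) ?measure0//.
  by apply/seteqP; split => // b; rewrite xsectionE => -[].
rewrite k_outside//; last exact: measurable_xsection measurable_wasteful.
rewrite diracE memNset// xsectionE => -[_ /=].
have [c0 nn] := selector_outside_V rA hf nVx.
by case=> // ; rewrite big1 ?ltxx// => j _; exact: c0.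
Qed.

Lemma occupation_wasteful : occ wasteful = 0.
Proof.
rewrite [LHS]occupationE; last exact: measurable_wasteful.
by apply: eseries0 => n _ _; exact: step_law_wasteful.
Qed.

(** Entering G from outside V is wasteful, hence has probability 0. This is what turns the one-sided
    balance into an equality on V. *)
Lemma step_law_next n (G : set state) : measurable G -> G `<=` V ->
  \int[step_law M pi s0 n]_p transition M p.1 p.2 G =
  step_law M pi s0 n (VB `&` [set p | G (next_state M p.1 p.2)]).
Proof.
move=> mG GV; rewrite integral_transition// setTI.
have mGn := mnext mG; have mI := measurableI _ _ measurable_VB mGn.
apply/eqP; rewrite eq_le; apply/andP; split; last first.
  by apply: le_measure; rewrite ?inE//; exact: subIsetr.
apply: (@le_trans _ _ (step_law M pi s0 n ((VB `&` [set p | G (next_state M p.1 p.2)]) `|` wasteful))).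
  apply: le_measure; rewrite ?inE//; first by apply: measurableU => //;
    exact: measurable_wasteful.
  move=> p Gp; have [Vp|nVp] := pselect (V p.1); first by left.
  by right; split => //; right; exact: GV.
apply: le_trans (measureU2 (step_law M pi s0 n) mI measurable_wasteful) _.
by rewrite [X in _ + X](_ : _ = 0) ?adde0//; exact: step_law_wasteful.
Qed.

Section below.
Variable mu : {measure set (state * action) -> \bar R}.
Hypothesis bal : subbalanced mu.
Hypothesis disint : forall G : set (state * action), measurable G -> G `<=` VB ->
  \int[pushforward mu fst]_(x in V) k x (xsection G x) = mu G.

Let step n := step_law M pi s0 n.

(** Induction through the marginals: the first N + 1 state laws sum to the initial mass plus the
    flow into G of the first N steps. By induction that flow is at most the one of mu, so balance
    bounds the sum by the marginal of mu; integrating the common kernel [k] gives the bound on V x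
    B. *)
Lemma partial_occupation_le N U : measurable U -> U `<=` VB ->
  \sum_(n < N) step n U <= mu U.
Proof.
elim: N U => [|N ih] U mU UVB; first by rewrite big_ord0.
have marg G : measurable G -> G `<=` V ->
    \sum_(n < N.+1) state_law M pi s0 n G <= pushforward mu fst G.
  move=> mG GV; rewrite big_ord_recl state_law0//.
  rewrite (_ : pushforward mu fst G = mu (G `*` setT)); last first.
    by congr (mu _); apply/seteqP; split => [[y b]|[y b] []].
  apply: le_trans (bal mG GV); rewrite leeD2l//.
  rewrite integral_transition//.
  under eq_bigr do rewrite /= state_lawS// step_law_next//.
  apply: ih; last exact: subIsetl.
  by apply: measurableI => //; exact: mnext.
(* The state laws are added up to a single measure, so that [marg] can be integrated by
   [le_measure_integral]. *)
pose sl n : {measure set state -> \bar R} := state_law M pi s0 n.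
have -> : \sum_(n < N.+1) step n U =
    \int[msum sl N.+1]_(x in V) k x (xsection U x).
  rewrite ge0_integral_measure_sum//; last first.
    by apply: measurable_funTS; apply: measurable_fun_xsection_finite_kernel;
      rewrite inE.
  apply: eq_bigr => n _; rewrite /step stationary_step_law// [RHS]integral_mkcond.
  apply: eq_integral => x _; rewrite patchE; case: ifPn => // xV.
  rewrite (_ : xsection _ _ = set0) ?measure0//.
  apply/seteqP; split => // b; rewrite xsectionE => /UVB[/= Vx _].
  by move: xV; rewrite mem_set.
rewrite -(disint mU UVB).
by apply: (@le_measure_integral _ _ _ (msum sl N.+1) (image_measure mu measurable_fst)).
Qed.

Lemma occupation_le U : measurable U -> U `<=` VB -> occ U <= mu U.
Proof.
move=> mU UVB; rewrite [leLHS]occupationE//; apply: lime_le.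
  by apply: is_cvg_nneseries => n _ _.
by apply: nearW => N; rewrite big_mkord; exact: partial_occupation_le.
Qed.

End below.

Lemma cost_occupation_VB j :
  cost_integral M setT occ j = cost_integral M VB occ j.
Proof.
have mc := @measurable_stage_cost _ _ _ _ M j.
rewrite /cost_integral -(setUv VB) ge0_integral_setU//; first last.
- by apply/disj_setPCl.
- by move=> p _; exact: stage_cost_ge0.
- exact: measurable_funTS.
- exact: measurableC.
rewrite [X in _ + X](_ : _ = 0) ?adde0//.
rewrite (@ge0_negligible_integral _ _ _ _ _ _ _ measurable_wasteful)//.
- apply: integral0_eq => p [nVp nw]; apply/eqP; rewrite eq_le stage_cost_ge0 andbT.
  rewrite leNgt; apply/negP => c0; apply: nw; split; first by move=> Vp; apply: nVp.
  left; apply: lt_le_trans c0 _; rewrite (bigD1 j)//= leeDl//.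
  by apply: sume_ge0 => i _; exact: stage_cost_ge0.
- exact: measurableC.
- exact: measurable_funTS.
- by move=> p _; exact: stage_cost_ge0.
- exact: occupation_wasteful.
Qed.

End comparison.

(** * The linear programs *)

(** The proofs are arguments so that the kernel structures below can be attached to the function.
    Measure values for [phi] cover both a constructed kernel and the given kernel of
    [disintegrates], measurable on V only. *)
Definition paste {R : realType} d d' (T : measurableType d)
    (B : measurableType d') (V : set T) (mV : measurable V)
    (phi : T -> {measure set B -> \bar R})
    (mphi : forall U, measurable U -> measurable_fun V (phi ^~ U))
    (phi1 : forall x, phi x setT = 1)
    (f : T -> B) (mf : measurable_fun setT f) (x : T) : {measure set B -> \bar R} :=
  if x \in V then phi x else \d_(f x).

Section paste.
Context {R : realType} d d' (T : measurableType d) (B : measurableType d').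
Variables (V : set T) (mV : measurable V) (phi : T -> {measure set B -> \bar R}).
Hypothesis mphi : forall U, measurable U -> measurable_fun V (phi ^~ U).
Hypothesis phi1 : forall x, phi x setT = 1.
Variables (f : T -> B) (mf : measurable_fun setT f).
Local Notation paste := (paste mV mphi phi1 mf).

Let measurable_paste U : measurable U -> measurable_fun setT (paste ^~ U).
Proof.
move=> mU; rewrite (_ : paste ^~ U = fun x => if x \in V then phi x U else \d_(f x) U).
  apply: measurable_fun_if => //.
  - apply: (measurable_fun_bool true); rewrite setTI.
    by rewrite (_ : _ @^-1` _ = V)//; apply/seteqP; split => x;
      [exact: set_mem|exact: mem_set].
  - rewrite setTI (_ : _ @^-1` _ = V); first exact: mphi.
    by apply/seteqP; split => x; [exact: set_mem|exact: mem_set].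
  - apply: measurable_funTS; rewrite (_ : (fun x => _) = EFin \o (\1_U \o f))//.
    by apply/measurable_EFinP; apply: measurableT_comp => //;
      exact: measurable_indic.
by apply/funext => x; rewrite /paste; case: ifP.
Qed.

HB.instance Definition _ := isKernel.Build _ _ _ _ R paste measurable_paste.

Let paste_prob x : paste x setT = 1.
Proof. by rewrite /paste; case: ifP => // _; rewrite /= diracT. Qed.

HB.instance Definition _ := Kernel_isProbability.Build _ _ _ _ R paste paste_prob.

Lemma paste_in x : V x -> paste x = phi x.
Proof. by move=> Vx; rewrite /paste mem_set. Qed.

Lemma paste_out x U : ~ V x -> paste x U = \d_(f x) U.
Proof. by move=> Vx; rewrite /paste memNset. Qed.

End paste.

Section programs.
Context {R : realType} {X A : ptopologicalType} {J : nat}.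
Variable M : impulse_model R X A J.
Local Notation state := (state X).
Local Notation action := (action R A).
Local Notation V := (Vset M).
Local Notation VB := (Vset M `*` [set: action]).
Hypothesis rA : @real_retract R _ action.
Hypothesis hII : condition_II M.
Variables (f : state -> action) (mf : measurable_fun setT f).
Hypothesis hf : optimal_selector M mf.
Variables (x0 : X) (d : 'I_J -> R).
Let s0 : state := Some x0.

Let mV : measurable V. Proof. exact: (measurable_Vset rA hf). Qed.
Let mVB : measurable VB. Proof. exact: measurableX. Qed.

Implicit Types mu : {measure set (state * action) -> \bar R}.

Lemma occupation_feasible_LP1 (pi : @strategy R X A) : feasible M x0 d pi ->
  feasible_LP1 M x0 d (occupation M pi s0).
Proof.
move=> fpi; split; first by move=> G mG; exact: occupation_balance.
by move=> j; rewrite -total_cost_occupation.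
Qed.

Lemma cost_VB_le mu j : cost_integral M VB mu j <= cost_integral M setT mu j.
Proof.
apply: ge0_subset_integral => //; first exact: measurable_stage_cost.
by move=> p _; exact: stage_cost_ge0.
Qed.

(** The common core: part (b) uses it with the given disintegration of an optimal measure,
    [subbalanced_stationary] with a constructed one. *)
Lemma paste_cost_le mu (phi : state -> {measure set action -> \bar R})
    (mphi : forall U, measurable U -> measurable_fun V (phi ^~ U))
    (phi1 : forall x, phi x setT = 1) :
  subbalanced M x0 mu ->
  (forall G : set (state * action), measurable G -> G `<=` VB ->
     \int[pushforward mu fst]_(x in V) phi x (xsection G x) = mu G) ->
  forall j, total_cost M (stationary (paste mV mphi phi1 mf)) s0 j <= cost_integral M VB mu j.
Proof.
move=> bal disint j; set k := paste mV mphi phi1 mf.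
have kout x : ~ V x -> forall U, measurable U -> k x U = \d_(f x) U.
  by move=> nVx U _; exact: paste_out.
rewrite total_cost_occupation// (cost_occupation_VB rA hf x0 kout).
apply: le_measure_integral; last by move=> p _; exact: stage_cost_ge0.
move=> U mU UVB; apply: (occupation_le rA hf kout bal) => // G mG GVB.
rewrite -disint//; apply: (@eq_integral _ _ _ (image_measure mu measurable_fst)) => x /set_mem Vx.
by transitivity (paste mV mphi phi1 mf x (xsection G x)) => //; rewrite paste_in.
Qed.

Lemma subbalanced_stationary mu : subbalanced M x0 mu ->
  (forall j, cost_integral M VB mu j < +oo) ->
  exists k : R.-pker state ~> action,
    (forall x, ~ V x -> forall U, measurable U -> k x U = \d_(f x) U) /\
    forall j, total_cost M (stationary k) s0 j <= cost_integral M VB mu j.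
Proof.
move=> bal coo.
have [phi disint] := @sigma_finite_disintegration R _ _ _ _ mu (costly_states M) rA
  (@measurable_costly_states R X A J M)
  (fun k => costly_marginal_finite rA hf k bal coo).
rewrite -(V_bigcup rA hII hf) in disint.
have mphi U : measurable U -> measurable_fun V (phi ^~ U).
  by move=> mU; apply: measurable_funTS; exact: measurable_kernel.
have phi1 x : phi x setT = 1 by exact: prob_kernel.
exists (paste mV mphi phi1 mf); split.
  by move=> x nVx U _; exact: paste_out.
apply: paste_cost_le => // G mG GVB; exact/esym/disint.
Qed.

(** Such a strategy never re-enters V, so restriction keeps the balance exact, and it is free
    outside V, so restriction keeps the costs. *)
Lemma restricted_occupation_feasible_LP2 (k : R.-pker state ~> action) :
  (forall x, ~ V x -> forall U, measurable U -> k x U = \d_(f x) U) ->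
  feasible M x0 d (stationary k) -> total_cost M (stationary k) s0 ord0 < +oo ->
  feasible_LP2 M x0 d (mrestr (occupation M (stationary k) s0) mVB) /\
  forall j, cost_integral M VB (mrestr (occupation M (stationary k) s0) mVB) j =
    total_cost M (stationary k) s0 j.
Proof.
move=> kout fk cost0oo.
pose occ : {measure set (state * action) -> \bar R} := occupation M (stationary k) s0.
have cE j : cost_integral M VB (mrestr (occupation M (stationary k) s0) mVB) j = total_cost M (stationary k) s0 j.
  rewrite [RHS]total_cost_occupation [RHS](cost_occupation_VB rA hf x0 kout).
  by apply: eq_measure_integral => U mU UVB; rewrite -[LHS]/(occ (U `&` VB)) setIidl.
split=> //; split.
- by rewrite -[LHS]/(occ (~` VB `&` VB)) setICl measure0.
(* Sigma-finiteness: the occupation measure is itself feasible for (LP1) with finite costs, so its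
   mass over each costly level is finite. *)
- exists (fun n => costly_states M n `*` setT); first exact: (VB_bigcup rA hII hf).
  move=> n; split; first by apply: measurableX => //;
    exact: measurable_costly_states.
  rewrite -[X in X < _]/(occ (costly_states M n `*` setT `&` VB)).
  rewrite setIidl; last first.
    by rewrite (VB_bigcup rA hII hf) => p cp; exists n.
  apply: (costly_marginal_finite rA hf).
    exact: (feasible_LP1_subbalanced (d := d) rA hf (occupation_feasible_LP1 fk)).
  move=> j; rewrite -(cost_occupation_VB rA hf x0 kout) -total_cost_occupation.
  have [i ->|->//] := unliftP ord0 j.
  by apply: le_lt_trans (fk i) _; exact: ltry.
- move=> G mG GV.
  rewrite -[LHS]/(occupation M (stationary k) s0 ((G `*` setT) `&` VB)) setIidl;
    last first.
    by move=> p [Gp _]; split => //; exact: GV.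
  have e := @occupation_balance _ _ _ _ M rA (stationary k) s0 G mG.
  rewrite e.
  apply: (congr1 (fun z => \d_s0 G + z)).
  transitivity (\int[occ]_(p in VB) transition M p.1 p.2 G); last first.
    by apply: eq_measure_integral => U mU UVB;
      rewrite -[RHS]/(occ (U `&` VB)) setIidl.
  have mtr := @measurable_transition R X A J M G mG.
  rewrite [LHS](@integral_occupation _ _ _ _ M (stationary k) s0 _ _ measurableT mtr)//.
  rewrite [RHS](@integral_occupation _ _ _ _ M (stationary k) s0 _ _ mVB mtr)//.
  apply: eq_eseriesr => n _.
  by rewrite (step_law_next rA hf x0 kout)// integral_transition.
- by move=> j; rewrite cE.
Qed.

Lemma feasible_LP2_subbalanced mu : feasible_LP2 M x0 d mu -> subbalanced M x0 mu.
Proof. by move=> [_ _ h _] G mG GV; rewrite h. Qed.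

Lemma finite_costs (c : 'I_J.+1 -> \bar R) : c ord0 < +oo ->
  (forall j, c (lift ord0 j) <= (d j)%:E) -> forall j, c j < +oo.
Proof.
move=> c0 cd j; have [i ->|->//] := unliftP ord0 j.
by apply: le_lt_trans (cd i) _; exact: ltry.
Qed.

Lemma dominating_strategy mu : subbalanced M x0 mu ->
  cost_integral M VB mu ord0 < +oo ->
  (forall j : 'I_J, cost_integral M VB mu (lift ord0 j) <= (d j)%:E) ->
  exists k : R.-pker state ~> action,
    [/\ forall x, ~ V x -> forall U, measurable U -> k x U = \d_(f x) U,
        feasible M x0 d (stationary k) &
        total_cost M (stationary k) s0 ord0 <= cost_integral M VB mu ord0].
Proof.
move=> bal c0 cd.
have [k [kout kc]] := subbalanced_stationary bal (finite_costs c0 cd).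
by exists k; split => // j; exact: le_trans (kc _) (cd j).
Qed.

Lemma value_LP1E : value_LP1 M x0 d = value M x0 d.
Proof.
apply/eqP; rewrite eq_le; apply/andP; split; apply: le_ereal_inf_tmp.
  move=> _ [pi fpi <-]; apply: ereal_inf_lbound.
  exists (occupation M pi s0); first exact: occupation_feasible_LP1.
  by rewrite total_cost_occupation.
move=> _ [mu fmu <-].
have [c0|] := ltP (cost_integral M setT mu ord0) +oo; last first.
  by rewrite leye_eq => /eqP ->; exact: leey.
have [|||k [_ fk kc]] := @dominating_strategy mu.
- exact: (feasible_LP1_subbalanced rA hf fmu).
- exact: le_lt_trans (cost_VB_le mu ord0) c0.
- by move=> j; apply: le_trans (cost_VB_le mu _) (fmu.2 j).
apply: le_trans (cost_VB_le mu ord0); apply: le_trans kc.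
by apply: ereal_inf_lbound; exists (stationary k).
Qed.

(** An arbitrary strategy may return to V from outside, so its restricted occupation measure need
    not be feasible. It is first replaced by a stationary strategy following f outside V that costs
    no more. *)
Lemma value_LP2E : value_LP2 M x0 d = value M x0 d.
Proof.
apply/eqP; rewrite eq_le; apply/andP; split; apply: le_ereal_inf_tmp.
  move=> _ [pi fpi <-].
  have [c0|] := ltP (total_cost M pi s0 ord0) +oo; last first.
    by rewrite leye_eq => /eqP ->; exact: leey.
  have fo := occupation_feasible_LP1 fpi; set mu := occupation M pi s0.
  have cmu j : cost_integral M VB mu j <= total_cost M pi s0 j.
    by rewrite total_cost_occupation; exact: cost_VB_le.
  have [|||k [kout fk kc]] := @dominating_strategy mu.
  - exact: (feasible_LP1_subbalanced rA hf fo).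
  - exact: le_lt_trans (cmu ord0) c0.
  - by move=> j; apply: le_trans (cmu _) (fpi j).
  have koo := le_lt_trans (le_trans kc (cmu ord0)) c0.
  have [fk2 ck2] := restricted_occupation_feasible_LP2 kout fk koo.
  apply: le_trans (le_trans kc (cmu ord0)); rewrite -ck2.
  by apply: ereal_inf_lbound; eexists; [exact: fk2|].
move=> _ [mu fmu <-].
have [c0|] := ltP (cost_integral M VB mu ord0) +oo; last first.
  by rewrite leye_eq => /eqP ->; exact: leey.
have [|||k [_ fk kc]] := @dominating_strategy mu.
- exact: feasible_LP2_subbalanced fmu.
- exact: c0.
- by case: fmu.
apply: le_trans kc.
by apply: ereal_inf_lbound; exists (stationary k).
Qed.

Lemma value_lty : condition_I M x0 d -> value M x0 d < +oo.
Proof.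
move=> [pi fpi c0]; apply: le_lt_trans c0.
by apply: ereal_inf_lbound; exists pi.
Qed.

Lemma optimal_LP1_value mu : optimal_LP1 M x0 d mu ->
  cost_integral M setT mu ord0 = value_LP1 M x0 d.
Proof.
move=> [fmu omu]; apply/eqP; rewrite eq_le; apply/andP; split.
  by apply: le_ereal_inf_tmp => _ [mu' fmu' <-]; exact: omu.
by apply: ereal_inf_lbound; exists mu.
Qed.

Lemma optimal_LP2_value mu : optimal_LP2 M x0 d mu ->
  cost_integral M VB mu ord0 = value_LP2 M x0 d.
Proof.
move=> [fmu omu]; apply/eqP; rewrite eq_le; apply/andP; split.
  by apply: le_ereal_inf_tmp => _ [mu' fmu' <-]; exact: omu.
by apply: ereal_inf_lbound; exists mu.
Qed.

End programs.

Unset Implicit Arguments.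

Theorem corollary3p2 (R : realType) (X A : ptopologicalType) (J : nat)
    (hX : borel_space R X) (hA : borel_space R A)
    (M : impulse_model R X A J) (x0 : X)
    (d : 'I_J -> R) (hd : forall j, (0 <= d j)%R)
    (hI : condition_I M x0 d) (hII : condition_II M)
    (f : state X -> action R A) (mf : measurable_fun [set: state X] f)
    (hf : optimal_selector M mf) :
  (value_LP1 M x0 d = value_LP2 M x0 d /\ value_LP2 M x0 d = value M x0 d) /\
  (forall (mu : {measure set (state X * action R A) -> \bar R})
      (phi : state X -> probability (action R A) R),
    optimal_LP2 M x0 d mu -> disintegrates M mu phi ->
    exists pi : R.-pker (state X) ~> (action R A),
      [/\ forall x, pi x = pasted M phi f x :> (set (action R A) -> \bar R),
          optimal_LP1 M x0 d (occupation M (stationary pi) (Some x0)),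
          feasible_LP1 M x0 d (occupation M (stationary pi) (Some x0)),
          cost_integral M setT (occupation M (stationary pi) (Some x0)) ord0
            < +oo
        & optimal M x0 d (stationary pi)]) /\
  ((exists mu, optimal_LP1 M x0 d mu) -> exists mu, optimal_LP2 M x0 d mu).
Proof.
have cA : compact [set: A] by case: hII.
have rA := real_retract_action hA cA.
have E1 := value_LP1E rA hII hf x0 d; have E2 := value_LP2E rA hII hf x0 d.
have voo := value_lty hI.
have mV := measurable_Vset rA hf.
split; first by rewrite E1 E2.
split=> [mu phi omu [mphi disint]|[mu omu]].
  have phi1 x : phi x setT = 1 by exact: probability_setT.
  pose k : R.-pker (state X) ~> (action R A) := @paste R _ _ _ _ _ mV (phi : state X -> {measure set (action R A) -> \bar R}) mphi phi1 f mf.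
  have [_ _ _ cmu] := omu.1.
  have kc := paste_cost_le rA hf mphi phi1 (feasible_LP2_subbalanced omu.1) disint.
  have fk : feasible M x0 d (stationary k) by move=> j; exact: le_trans (kc _) (cmu j).
  have ck : total_cost M (stationary k) (Some x0) ord0 <= value M x0 d.
    by rewrite -E2 -(optimal_LP2_value omu); exact: kc.
  have f1 := occupation_feasible_LP1 rA fk.
  have cE : cost_integral M setT (occupation M (stationary k) (Some x0)) ord0 =
    total_cost M (stationary k) (Some x0) ord0 by rewrite total_cost_occupation.
  have c1 : cost_integral M setT (occupation M (stationary k) (Some x0)) ord0 <=
    value M x0 d by rewrite cE.
  exists k; split.
  - move=> x; rewrite /pasted; have [Vx|nVx] := pselect (Vset M x).
      by rewrite mem_set//; apply/funext => U; rewrite -[LHS]/(paste mV mphi phi1 mf x U) paste_in.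
    by rewrite (memNset nVx); apply/funext => U; exact: (paste_out mV mphi phi1 mf U nVx).
  - split; first exact: f1.
    move=> mu' fmu'; apply: le_trans c1 _; rewrite -E1.
    by apply: ereal_inf_lbound; exists mu'.
  - exact: f1.
  - exact: le_lt_trans c1 voo.
  - split; first exact: fk.
    move=> pi' fpi'; apply: le_trans ck _.
    by apply: ereal_inf_lbound; exists pi'.
(* Part (c): the solution produced is not the restriction of [mu] but the restricted occupation
   measure of a strategy dominating it. *)
have cmu : cost_integral M (Vset M `*` setT) mu ord0 <= value M x0 d.
  by rewrite -E1 -(optimal_LP1_value omu); exact: (cost_VB_le rA hf mu ord0).
have bal := feasible_LP1_subbalanced rA hf omu.1.
have cd j : cost_integral M (Vset M `*` setT) mu (lift ord0 j) <= (d j)%:E.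
  by apply: le_trans (cost_VB_le rA hf mu _) (omu.1.2 j).
have [k [kout fk kc]] := dominating_strategy rA hII hf bal (le_lt_trans cmu voo) cd.
have ck := le_trans kc cmu.
have [fk2 ck2] := restricted_occupation_feasible_LP2 rA hII hf kout fk (le_lt_trans ck voo).
eexists; split; first exact: fk2.
move=> mu' fmu'; rewrite ck2; apply: le_trans ck _; rewrite -E2.
by apply: ereal_inf_lbound; exists mu'.
Qed.
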